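(* Let $\mathcal V$ be a Cartesian closed category with finite limits and small coproducts, and assume that the following equivalent conditions hold: (1) for every set $I$ the adjunction $\amalg\dashv\langle i^*\rangle_{i\in I}$ between $\mathcal V^I$ and $\mathcal V/(I\bullet1)$ is an adjoint equivalence; (2) $\mathcal V$ is extensive; (3) the oplax double functor $\operatorname{Int}:\mathcal V\text{-}\mathrm{Mat}\to\operatorname{Span}_d(\mathcal V)$ is a double equivalence; (4) the lax double functor $\operatorname{En}:\operatorname{Span}_d(\mathcal V)\to\mathcal V\text{-}\mathrm{Mat}$ is a double equivalence. Then the category $\mathcal V\text{-}\mathrm{Cat}$ of $\mathcal V$-enriched categories and the category $\mathrm{Cat}_d(\mathcal V)$ of discretely internal categories in $\mathcal V$ are equivalent.
   Context: $1$ is the terminal object; $I\bullet 1$ is the coproduct of $I$ copies of $1$, with coprojections $\bar i:1\to I\bullet1$; a map of sets $u:I\to K$ induces $u\bullet1:I\bullet1\to K\bullet1$. Extensive: $\mathcal V$ has all small coproducts and for each small family $(X_i)_{i\in I}$ the functor $\prod_{i}(\mathcal V/X_i)\to\mathcal V/(\amalg_{i}X_i)$, $(f_i)\mapsto\amalg_i f_i$, is an equivalence of categories. For $X_i=1$ this functor is $\amalg:\mathcal V^I\to\mathcal V/(I\bullet 1)$; its right adjoint $\langle i^*\rangle$ has as $i$-th component the pullback along $\bar i$. $\operatorname{Span}_d(\mathcal V)$ is the pseudo-double category of small sets, horizontal 1-cells $I\to J$ the spans $I\bullet1\xleftarrow{a_1}A\xrightarrow{a_2}J\bullet1$ in $\mathcal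 V$ (composed by pullback), vertical 1-cells the maps of sets, and 2-cells from $(A,a_1,a_2)$ to $(B,b_1,b_2)$ over $u,v$ the morphisms $f:A\to B$ with $b_1f=(u\bullet1)a_1$, $b_2f=(v\bullet1)a_2$. $\mathcal V\text{-}\mathrm{Mat}$ is the pseudo-double category of small sets, horizontal 1-cells $I\to J$ the matrices $(M(i,j))_{i\in I,j\in J}$ of objects of $\mathcal V$ (composed by the matrix product using $\times$ and coproducts), vertical 1-cells the maps of sets, and 2-cells from $M$ to $N$ over $u,v$ the families $f_{i,j}:M(i,j)\to N(u(i),v(j))$. $\operatorname{Int}$ is the identity on sets and maps and sends $M$ to $I\bullet1\leftarrow\amalg_{i,j}M(i,j)\to J\bullet1$ (legs on $M(i,j)$: unique map to $1$ followed by $\bar i$, resp. $\bar j$). $\operatorname{En}$ is the identity on sets and maps and sends a span $(A,v_I,v_J)$ to the matrix whose $(i,j)$ entry is the pullback of $\langle v_I,v_J\rangle:A\to(I\bullet1)\times(J\bullet1)$ along $\langle\bar i,\bar j\rangle$. $\mathcal V\text{-}\mathrm{Cat}$: small categories enriched in $\mathcal V$ with its Cartesian monoidal structure, and enriched functors. $\mathrm{Cat}_d(\mathcal V)$: discretely internal categories, i.e. a set $I$ together with a category internal in $\mathcal V$ whose object of objects is $I\bullet 1$ (monads in $\operatorname{Span}_d(\mathcal V)$); morphisms are internal functors whose object component is $u\bullet 1$ for a specified map of sets $u$ (vertical 1-cells of monads in $\operatorname{Span}_d(\mathcal V)$). *)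

(* Defs.v *)
From Stdlib Require Import ssreflect List Bool FunctionalExtensionality ProofIrrelevance.

Set Implicit Arguments.
Unset Strict Implicit.
Unset Printing Implicit Defensive.

(* The universe of small sets.  Hom-sets are small; objects may form a larger
   collection. *)
Definition small := Type.

Declare Scope cat_scope.
Delimit Scope cat_scope with cat.
Local Open Scope cat_scope.

Record Category := {
  Ob :> Type;
  Hom : Ob -> Ob -> small;
  idm : forall A, Hom A A;
  comp : forall A B C, Hom B C -> Hom A B -> Hom A C;
  comp_assoc : forall A B C D (h : Hom C D) (g : Hom B C) (f : Hom A B),
    comp h (comp g f) = comp (comp h g) f;
  comp_idl : forall A B (f : Hom A B), comp (idm B) f = f;
  comp_idr : forall A B (f : Hom A B), comp f (idm A) = f }.

Arguments Hom {c} _ _.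
Arguments idm {c} A.
Arguments comp {c A B C} _ _.

Notation "g ∘ f" := (comp g f) (at level 40, left associativity) : cat_scope.

Definition is_iso (C : Category) (A B : C) (f : Hom A B) : Prop :=
  exists g : Hom B A, g ∘ f = idm A /\ f ∘ g = idm B.

Record Functor (C D : Category) := {
  fobj :> C -> D;
  fmap : forall A B, Hom A B -> Hom (fobj A) (fobj B);
  fmap_id : forall A, fmap (idm A) = idm (fobj A);
  fmap_comp : forall A B E (g : Hom B E) (f : Hom A B),
    fmap (g ∘ f) = fmap g ∘ fmap f }.

Arguments fmap {C D} _ {A B} _.

Definition functor_id (C : Category) : Functor C C.
Proof.
  refine {| fobj := fun A => A; fmap := fun A B f => f |}; reflexivity.
Defined.

Definition functor_comp (C D E : Category) (G : Functor D E) (F : Functor C D) :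
  Functor C E.
Proof.
  refine {| fobj := fun A => G (F A); fmap := fun A B f => fmap G (fmap F f) |}.
  - intros A. now rewrite !fmap_id.
  - intros. now rewrite !fmap_comp.
Defined.

Record NatTrans (C D : Category) (F G : Functor C D) := {
  nt :> forall A, Hom (F A) (G A);
  nt_nat : forall A B (f : Hom A B), nt B ∘ fmap F f = fmap G f ∘ nt A }.

Definition nat_iso (C D : Category) (F G : Functor C D) (t : NatTrans F G) : Prop :=
  forall A, is_iso (t A).

Definition is_equivalence (C D : Category) (F : Functor C D) : Prop :=
  exists (G : Functor D C) (eta : NatTrans (functor_id C) (functor_comp G F))
         (eps : NatTrans (functor_comp F G) (functor_id D)),
    nat_iso eta /\ nat_iso eps.

Definition equivalent_categories (C D : Category) : Prop :=
  exists F : Functor C D, is_equivalence F.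

Record Adjunction (C D : Category) (F : Functor C D) (G : Functor D C) := {
  adj_unit : NatTrans (functor_id C) (functor_comp G F);
  adj_counit : NatTrans (functor_comp F G) (functor_id D);
  adj_triangle_l : forall A : C, adj_counit (F A) ∘ fmap F (adj_unit A) = idm (F A);
  adj_triangle_r : forall B : D, fmap G (adj_counit B) ∘ adj_unit (G B) = idm (G B) }.

Definition is_adjoint_equivalence (C D : Category) (F : Functor C D)
    (G : Functor D C) (a : Adjunction F G) : Prop :=
  nat_iso (adj_unit a) /\ nat_iso (adj_counit a).

Definition SetCat : Category.
Proof.
  refine {| Ob := small; Hom := fun A B => A -> B; idm := fun A x => x;
            comp := fun A B C g f x => g (f x) |}; reflexivity.
Defined.

Definition prod_cat (I : small) (C : I -> Category) : Category.
Proof.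
  refine {| Ob := forall i, C i; Hom := fun X Y => forall i, Hom (X i) (Y i);
            idm := fun X i => idm (X i); comp := fun X Y Z g f i => g i ∘ f i |};
  intros; apply functional_extensionality_dep; intros.
  - apply comp_assoc.
  - apply comp_idl.
  - apply comp_idr.
Defined.

Definition power_cat (V : Category) (I : small) : Category :=
  prod_cat (fun _ : I => V).

Record SliceOb (V : Category) (X : V) := {
  so_dom : V;
  so_map : Hom so_dom X }.

Record SliceHom (V : Category) (X : V) (A B : SliceOb X) := {
  sh_map : Hom (so_dom A) (so_dom B);
  sh_comm : so_map B ∘ sh_map = so_map A }.

Lemma slice_hom_eq (V : Category) (X : V) (A B : SliceOb X) (f g : SliceHom A B) :
  sh_map f = sh_map g -> f = g.
Proof.
  destruct f as [f ef], g as [g eg]; cbn; intros e; subst g.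
  now rewrite (proof_irrelevance _ ef eg).
Qed.

Definition slice (V : Category) (X : V) : Category.
Proof.
  unshelve refine {| Ob := SliceOb X; Hom := @SliceHom V X;
    idm := fun A => {| sh_map := idm (so_dom A) |};
    comp := fun A B C g f => {| sh_map := sh_map g ∘ sh_map f |} |}.
  - apply comp_idr.
  - now rewrite comp_assoc !sh_comm.
  - intros; apply slice_hom_eq, comp_assoc.
  - intros; apply slice_hom_eq, comp_idl.
  - intros; apply slice_hom_eq, comp_idr.
Defined.

Record Cone (J V : Category) (D : Functor J V) := {
  apex : V;
  leg : forall j, Hom apex (D j);
  leg_nat : forall j k (f : Hom j k), fmap D f ∘ leg j = leg k }.

Record Limit (J V : Category) (D : Functor J V) := {
  lim :> Cone D;
  lim_lift : forall K : Cone D, Hom (apex K) (apex lim);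
  lim_fac : forall (K : Cone D) j, leg lim j ∘ lim_lift K = leg K j;
  lim_uniq : forall (K : Cone D) (h : Hom (apex K) (apex lim)),
    (forall j, leg lim j ∘ h = leg K j) -> h = lim_lift K }.

Definition finite_type (T : Type) : Prop := exists l : list T, forall x, In x l.

Definition finite_category (J : Category) : Prop :=
  finite_type J /\ forall a b : J, finite_type (Hom a b).

Definition FiniteLimits (V : Category) : Type :=
  forall J : Category, finite_category J -> forall D : Functor J V, Limit D.

Record Coproduct (V : Category) (I : small) (X : I -> V) := {
  cop_ob : V;
  cop_in : forall i, Hom (X i) cop_ob;
  cop_case : forall A, (forall i, Hom (X i) A) -> Hom cop_ob A;
  cop_fac : forall A (f : forall i, Hom (X i) A) i, cop_case f ∘ cop_in i = f i;
  cop_uniq : forall A (f : forall i, Hom (X i) A) (h : Hom cop_ob A),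
    (forall i, h ∘ cop_in i = f i) -> h = cop_case f }.

Definition SmallCoproducts (V : Category) : Type :=
  forall (I : small) (X : I -> V), Coproduct X.

(* The shapes of terminal objects, binary products and pullbacks are preorders. *)
Definition preorder_cat (T : Type) (r : T -> T -> bool)
  (r_refl : forall a, r a a = true)
  (r_trans : forall a b c, r b c = true -> r a b = true -> r a c = true) : Category.
Proof.
  refine {| Ob := T; Hom := fun a b => r a b = true; idm := r_refl;
            comp := fun a b c g f => r_trans a b c g f |};
  intros; apply proof_irrelevance.
Defined.

Lemma preorder_cat_finite (T : Type) (r : T -> T -> bool) r_refl r_trans :
  finite_type T -> finite_category (@preorder_cat T r r_refl r_trans).
Proof.
  intros fT; split; [exact fT|]; intros a b; cbn.
  destruct (bool_dec (r a b) true) as [e|n].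
  - exists (e :: nil); intros x; left; apply proof_irrelevance.
  - exists nil; intros x; contradiction.
Qed.

Definition empty_shape : Category.
Proof. now refine (@preorder_cat Empty_set (fun _ _ => true) _ _). Defined.

Definition pair_shape : Category.
Proof.
  refine (@preorder_cat bool Bool.eqb _ _).
  - now intros [].
  - now intros [] [] [].
Defined.

(* [Some true] and [Some false] are the feet of the cospan, [None] its vertex. *)
Definition cospan_le (a b : option bool) : bool :=
  match a, b with
  | _, None => true
  | Some x, Some y => Bool.eqb x y
  | None, Some _ => false
  end.

Definition cospan_shape : Category.
Proof.
  refine (@preorder_cat (option bool) cospan_le _ _).
  - now intros [[]|].
  - now intros [[]|] [[]|] [[]|].
Defined.

Lemma empty_shape_finite : finite_category empty_shape.
Proof. apply preorder_cat_finite; exists nil; intros []. Qed.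

Lemma pair_shape_finite : finite_category pair_shape.
Proof.
  apply preorder_cat_finite; exists (true :: false :: nil); intros []; cbn; auto.
Qed.

Lemma cospan_shape_finite : finite_category cospan_shape.
Proof.
  apply preorder_cat_finite; exists (Some true :: Some false :: None :: nil).
  intros [[]|]; cbn; auto.
Qed.

Definition empty_diagram (V : Category) : Functor empty_shape V.
Proof.
  unshelve refine {| fobj := fun x : empty_shape => match x with end |};
  intros [].
Defined.

Definition pair_diagram (V : Category) (A B : V) : Functor pair_shape V.
Proof.
  unshelve refine {| fobj := fun x : pair_shape => if x then A else B;
    fmap := fun x y : bool =>
      match x, y return Bool.eqb x y = true -> Hom (if x then A else B) (if y then A else B)
      with
      | true, true => fun _ => idm A
      | false, false => fun _ => idm B
      | true, false | false, true => fun e => match Bool.diff_false_true e with end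
      end |}.
  - now intros [].
  - intros [] [] [] g f; try discriminate; cbn; now rewrite comp_idl.
Defined.

Definition cospan_ob (V : Category) (A B C : V) (x : option bool) : V :=
  match x with Some true => A | Some false => B | None => C end.

Definition cospan_diagram (V : Category) (A B C : V) (f : Hom A C) (g : Hom B C) :
  Functor cospan_shape V.
Proof.
  unshelve refine {| fobj := @cospan_ob V A B C : cospan_shape -> V;
    fmap := fun x y : option bool =>
      match x, y return cospan_le x y = true ->
        Hom (cospan_ob A B C x) (cospan_ob A B C y)
      with
      | Some true, Some true => fun _ => idm A
      | Some false, Some false => fun _ => idm B
      | None, None => fun _ => idm C
      | Some true, None => fun _ => f
      | Some false, None => fun _ => g
      | Some true, Some false | Some false, Some true
      | None, Some _ => fun e => match Bool.diff_false_true e with end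
      end |}.
  - now intros [[]|].
  - intros [[]|] [[]|] [[]|] h k; try discriminate; cbn;
      now rewrite ?comp_idl ?comp_idr.
Defined.

Section FiniteLimitOperations.
Context (V : Category) (L : FiniteLimits V).

Definition lim_terminal : V := apex (L empty_shape_finite (empty_diagram V)).

Definition empty_cone (A : V) : Cone (empty_diagram V).
Proof. unshelve refine {| apex := A |}; intros []. Defined.

Definition lim_bang (A : V) : Hom A lim_terminal :=
  lim_lift (L empty_shape_finite (empty_diagram V)) (empty_cone A).

Lemma lim_bang_uniq (A : V) (f g : Hom A lim_terminal) : f = g.
Proof.
  transitivity (lim_lift (L empty_shape_finite (empty_diagram V)) (empty_cone A));
    [|symmetry]; apply (lim_uniq (K := empty_cone A)); intros [].
Qed.

Definition lim_prod (A B : V) : V := apex (L pair_shape_finite (pair_diagram A B)).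

Definition lim_pr1 (A B : V) : Hom (lim_prod A B) A :=
  leg (L pair_shape_finite (pair_diagram A B)) (true : pair_shape).

Definition lim_pr2 (A B : V) : Hom (lim_prod A B) B :=
  leg (L pair_shape_finite (pair_diagram A B)) (false : pair_shape).

Definition pair_cone (X A B : V) (f : Hom X A) (g : Hom X B) : Cone (pair_diagram A B).
Proof.
  refine (@Build_Cone pair_shape V (pair_diagram A B) X (fun x : bool =>
    if x return Hom X (if x then A else B) then f else g) _).
  intros [] [] e; try discriminate; apply comp_idl.
Defined.

Definition lim_pair (X A B : V) (f : Hom X A) (g : Hom X B) : Hom X (lim_prod A B) :=
  lim_lift (L pair_shape_finite (pair_diagram A B)) (pair_cone f g).

Lemma lim_pr1_pair (X A B : V) (f : Hom X A) (g : Hom X B) :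
  lim_pr1 A B ∘ lim_pair f g = f.
Proof.
  exact (lim_fac (L pair_shape_finite (pair_diagram A B)) (pair_cone f g)
           (true : pair_shape)).
Qed.

Lemma lim_pr2_pair (X A B : V) (f : Hom X A) (g : Hom X B) :
  lim_pr2 A B ∘ lim_pair f g = g.
Proof.
  exact (lim_fac (L pair_shape_finite (pair_diagram A B)) (pair_cone f g)
           (false : pair_shape)).
Qed.

Lemma lim_prod_ext (X A B : V) (h k : Hom X (lim_prod A B)) :
  lim_pr1 A B ∘ h = lim_pr1 A B ∘ k -> lim_pr2 A B ∘ h = lim_pr2 A B ∘ k -> h = k.
Proof.
  intros e1 e2.
  pose (K := pair_cone (lim_pr1 A B ∘ k) (lim_pr2 A B ∘ k)).
  transitivity (lim_lift (L pair_shape_finite (pair_diagram A B)) K).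
  - apply (lim_uniq (K := K)); intros []; [exact e1 | exact e2].
  - symmetry; apply (lim_uniq (K := K)); now intros [].
Qed.

Context (A B C : V) (f : Hom A C) (g : Hom B C).

Definition lim_pb : V := apex (L cospan_shape_finite (cospan_diagram f g)).

Definition lim_pb1 : Hom lim_pb A :=
  leg (L cospan_shape_finite (cospan_diagram f g)) (Some true : cospan_shape).

Definition lim_pb2 : Hom lim_pb B :=
  leg (L cospan_shape_finite (cospan_diagram f g)) (Some false : cospan_shape).

Lemma lim_pb_comm : f ∘ lim_pb1 = g ∘ lim_pb2.
Proof.
  pose (P := L cospan_shape_finite (cospan_diagram f g)).
  transitivity (leg P (None : cospan_shape)).
  - exact (leg_nat P (j := Some true : cospan_shape) (k := None : cospan_shape)
             (eq_refl : cospan_le (Some true) None = true)).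
  - symmetry.
    exact (leg_nat P (j := Some false : cospan_shape) (k := None : cospan_shape)
             (eq_refl : cospan_le (Some false) None = true)).
Qed.

Definition cospan_cone (X : V) (h : Hom X A) (k : Hom X B) (e : f ∘ h = g ∘ k) :
  Cone (cospan_diagram f g).
Proof.
  refine (@Build_Cone cospan_shape V (cospan_diagram f g) X (fun x : option bool =>
    match x return Hom X (cospan_ob A B C x) with
    | Some true => h | Some false => k | None => f ∘ h end) _).
  intros [[]|] [[]|] l; try discriminate; cbn; rewrite ?comp_idl; auto.
Defined.

Definition lim_pb_lift (X : V) (h : Hom X A) (k : Hom X B) (e : f ∘ h = g ∘ k) :
  Hom X lim_pb :=
  lim_lift (L cospan_shape_finite (cospan_diagram f g)) (cospan_cone e).

Lemma lim_pb1_lift X (h : Hom X A) (k : Hom X B) (e : f ∘ h = g ∘ k) :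
  lim_pb1 ∘ lim_pb_lift e = h.
Proof.
  exact (lim_fac (L cospan_shape_finite (cospan_diagram f g)) (cospan_cone e)
           (Some true : cospan_shape)).
Qed.

Lemma lim_pb2_lift X (h : Hom X A) (k : Hom X B) (e : f ∘ h = g ∘ k) :
  lim_pb2 ∘ lim_pb_lift e = k.
Proof.
  exact (lim_fac (L cospan_shape_finite (cospan_diagram f g)) (cospan_cone e)
           (Some false : cospan_shape)).
Qed.

Lemma lim_pb_ext X (h k : Hom X lim_pb) :
  lim_pb1 ∘ h = lim_pb1 ∘ k -> lim_pb2 ∘ h = lim_pb2 ∘ k -> h = k.
Proof.
  intros e1 e2.
  assert (e : f ∘ (lim_pb1 ∘ k) = g ∘ (lim_pb2 ∘ k)).
  { now rewrite !comp_assoc lim_pb_comm. }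
  assert (en : forall m : Hom X lim_pb,
    leg (L cospan_shape_finite (cospan_diagram f g)) (None : cospan_shape) ∘ m
    = f ∘ (lim_pb1 ∘ m)).
  { intros m; rewrite comp_assoc; f_equal; symmetry.
    exact (leg_nat (L cospan_shape_finite (cospan_diagram f g))
             (j := Some true : cospan_shape) (k := None : cospan_shape)
             (eq_refl : cospan_le (Some true) None = true)). }
  transitivity (lim_lift (L cospan_shape_finite (cospan_diagram f g)) (cospan_cone e)).
  - apply (lim_uniq (K := cospan_cone e)); intros [[]|].
    + exact e1.
    + exact e2.
    + transitivity (f ∘ (lim_pb1 ∘ h)); [apply en | now rewrite e1].
  - symmetry; apply (lim_uniq (K := cospan_cone e)); intros [[]|].
    + reflexivity.
    + reflexivity.
    + apply en.
Qed.

End FiniteLimitOperations.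

Record Exponential (V : Category) (L : FiniteLimits V) (A B : V) := {
  exp_ob : V;
  exp_ev : Hom (lim_prod L exp_ob A) B;
  exp_cur : forall X, Hom (lim_prod L X A) B -> Hom X exp_ob;
  exp_fac : forall X (f : Hom (lim_prod L X A) B),
    exp_ev ∘ lim_pair L (exp_cur f ∘ lim_pr1 L X A) (lim_pr2 L X A) = f;
  exp_uniq : forall X (f : Hom (lim_prod L X A) B) (h : Hom X exp_ob),
    exp_ev ∘ lim_pair L (h ∘ lim_pr1 L X A) (lim_pr2 L X A) = f -> h = exp_cur f }.

(* A cartesian closed category with finite limits and small coproducts, all chosen. *)
Record BaseCategory := {
  base_cat :> Category;
  base_lim : FiniteLimits base_cat;
  base_cop : SmallCoproducts base_cat;
  base_exp : forall A B : base_cat, Exponential base_lim A B }.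

Arguments base_lim : clear implicits.
Arguments base_cop : clear implicits.
Arguments base_exp {b} A B.

Section BaseOperations.
Context {V : BaseCategory}.

Definition one : V := lim_terminal (base_lim V).
Definition bang (A : V) : Hom A one := lim_bang (base_lim V) A.
Definition times (A B : V) : V := lim_prod (base_lim V) A B.
Definition pr1 {A B : V} : Hom (times A B) A := lim_pr1 (base_lim V) A B.
Definition pr2 {A B : V} : Hom (times A B) B := lim_pr2 (base_lim V) A B.
Definition pair {X A B : V} (f : Hom X A) (g : Hom X B) : Hom X (times A B) :=
  lim_pair (base_lim V) f g.
Definition tmap {A B A' B' : V} (f : Hom A A') (g : Hom B B') :
  Hom (times A B) (times A' B') := pair (f ∘ pr1) (g ∘ pr2).
Definition pb {A B C : V} (f : Hom A C) (g : Hom B C) : V := lim_pb (base_lim V) f g.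
Definition pb1 {A B C : V} {f : Hom A C} {g : Hom B C} : Hom (pb f g) A :=
  lim_pb1 (base_lim V) f g.
Definition pb2 {A B C : V} {f : Hom A C} {g : Hom B C} : Hom (pb f g) B :=
  lim_pb2 (base_lim V) f g.
Definition pb_lift {A B C : V} {f : Hom A C} {g : Hom B C} {X : V}
  (h : Hom X A) (k : Hom X B) (e : f ∘ h = g ∘ k) : Hom X (pb f g) :=
  lim_pb_lift (base_lim V) e.
Definition coprod {I : small} (X : I -> V) : V := cop_ob (base_cop V I X).
Definition inj {I : small} (X : I -> V) (i : I) : Hom (X i) (coprod X) :=
  cop_in (base_cop V I X) i.
Definition copair {I : small} {X : I -> V} {A : V} (f : forall i, Hom (X i) A) :
  Hom (coprod X) A := cop_case (base_cop V I X) f.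

Lemma one_uniq {A : V} (f g : Hom A one) : f = g.
Proof. apply lim_bang_uniq. Qed.

Lemma pr1_pair {X A B : V} (f : Hom X A) (g : Hom X B) : pr1 ∘ pair f g = f.
Proof. apply lim_pr1_pair. Qed.

Lemma pr2_pair {X A B : V} (f : Hom X A) (g : Hom X B) : pr2 ∘ pair f g = g.
Proof. apply lim_pr2_pair. Qed.

Lemma times_ext {X A B : V} (h k : Hom X (times A B)) :
  pr1 ∘ h = pr1 ∘ k -> pr2 ∘ h = pr2 ∘ k -> h = k.
Proof. apply lim_prod_ext. Qed.

Lemma pair_comp {X Y A B : V} (f : Hom X A) (g : Hom X B) (h : Hom Y X) :
  pair f g ∘ h = pair (f ∘ h) (g ∘ h).
Proof. apply times_ext; now rewrite comp_assoc ?pr1_pair ?pr2_pair. Qed.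

Lemma pair_pr {A B : V} : pair pr1 pr2 = idm (times A B).
Proof. apply times_ext; now rewrite ?pr1_pair ?pr2_pair comp_idr. Qed.

Lemma pair_eta {X A B : V} (h : Hom X (times A B)) : pair (pr1 ∘ h) (pr2 ∘ h) = h.
Proof. apply times_ext; now rewrite ?pr1_pair ?pr2_pair. Qed.

Lemma pb_comm {A B C : V} {f : Hom A C} {g : Hom B C} : f ∘ pb1 = g ∘ @pb2 A B C f g.
Proof. apply lim_pb_comm. Qed.

Lemma pb1_lift {A B C : V} {f : Hom A C} {g : Hom B C} {X : V}
  (h : Hom X A) (k : Hom X B) (e : f ∘ h = g ∘ k) : pb1 ∘ pb_lift e = h.
Proof. apply lim_pb1_lift. Qed.

Lemma pb2_lift {A B C : V} {f : Hom A C} {g : Hom B C} {X : V}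
  (h : Hom X A) (k : Hom X B) (e : f ∘ h = g ∘ k) : pb2 ∘ pb_lift e = k.
Proof. apply lim_pb2_lift. Qed.

Lemma pb_ext {A B C : V} {f : Hom A C} {g : Hom B C} {X : V} (h k : Hom X (pb f g)) :
  pb1 ∘ h = pb1 ∘ k -> pb2 ∘ h = pb2 ∘ k -> h = k.
Proof. apply lim_pb_ext. Qed.

Lemma copair_inj {I : small} {X : I -> V} {A : V} (f : forall i, Hom (X i) A) i :
  copair f ∘ inj X i = f i.
Proof. apply cop_fac. Qed.

Lemma coprod_ext {I : small} {X : I -> V} {A : V} (h k : Hom (coprod X) A) :
  (forall i, h ∘ inj X i = k ∘ inj X i) -> h = k.
Proof.
  intros e; transitivity (copair (fun i => k ∘ inj X i)).
  - now apply (cop_uniq (c := base_cop V I X)).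
  - symmetry; now apply (cop_uniq (c := base_cop V I X)).
Qed.

Definition coprod_map {I J : small} {X : I -> V} {Y : J -> V} (u : I -> J)
  (f : forall i, Hom (X i) (Y (u i))) : Hom (coprod X) (coprod Y) :=
  copair (fun i => inj Y (u i) ∘ f i).

(* Products distribute over coproducts, by cartesian closedness: [casel] and
   [caser] define a map out of (coprod X) * A, resp. A * (coprod X), by cases. *)

Definition cur {X A B : V} (f : Hom (times X A) B) : Hom X (exp_ob (base_exp A B)) :=
  exp_cur (base_exp A B) f.

Definition ev {A B : V} : Hom (times (exp_ob (base_exp A B)) A) B :=
  exp_ev (base_exp A B).

Lemma ev_cur {X A B : V} (f : Hom (times X A) B) : ev ∘ tmap (cur f) (idm A) = f.
Proof. unfold tmap; rewrite comp_idl. apply exp_fac. Qed.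

Lemma ev_cur' {X Y A B : V} (f : Hom (times X A) B) (g : Hom Y X) (h : Hom Y A) :
  ev ∘ pair (cur f ∘ g) h = f ∘ pair g h.
Proof.
  rewrite <- (ev_cur f) at 2; unfold tmap.
  now rewrite -comp_assoc pair_comp -!comp_assoc pr1_pair pr2_pair comp_idl.
Qed.

Lemma ev_ext {X A B : V} (g h : Hom X (exp_ob (base_exp A B))) :
  ev ∘ tmap g (idm A) = ev ∘ tmap h (idm A) -> g = h.
Proof.
  unfold tmap; rewrite comp_idl; intros e.
  transitivity (cur (ev ∘ pair (h ∘ pr1) pr2)).
  - now apply (exp_uniq (e := base_exp A B)).
  - symmetry; now apply (exp_uniq (e := base_exp A B)).
Qed.

Definition swap {A B : V} : Hom (times A B) (times B A) := pair pr2 pr1.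

Definition casel {I : small} {X : I -> V} {A B : V}
  (f : forall i, Hom (times (X i) A) B) : Hom (times (coprod X) A) B :=
  ev ∘ tmap (copair (fun i => cur (f i))) (idm A).

Definition caser {I : small} {X : I -> V} {A B : V}
  (f : forall i, Hom (times A (X i)) B) : Hom (times A (coprod X)) B :=
  casel (fun i => f i ∘ swap) ∘ swap.

Lemma casel_inj {I : small} {X : I -> V} {A B Y : V}
  (f : forall i, Hom (times (X i) A) B) i (g : Hom Y (X i)) (h : Hom Y A) :
  casel f ∘ pair (inj X i ∘ g) h = f i ∘ pair g h.
Proof.
  unfold casel, tmap.
  rewrite -comp_assoc pair_comp -!comp_assoc pr1_pair pr2_pair comp_idl.
  now rewrite (comp_assoc (copair _)) copair_inj ev_cur'.
Qed.

Lemma caser_inj {I : small} {X : I -> V} {A B Y : V}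
  (f : forall i, Hom (times A (X i)) B) i (g : Hom Y A) (h : Hom Y (X i)) :
  caser f ∘ pair g (inj X i ∘ h) = f i ∘ pair g h.
Proof.
  unfold caser, swap.
  rewrite -comp_assoc pair_comp pr1_pair pr2_pair casel_inj.
  now rewrite -comp_assoc pair_comp pr1_pair pr2_pair.
Qed.

Lemma casel_ext {I : small} {X : I -> V} {A B : V} (h k : Hom (times (coprod X) A) B) :
  (forall i, h ∘ pair (inj X i ∘ pr1) pr2 = k ∘ pair (inj X i ∘ pr1) pr2) -> h = k.
Proof.
  intros e.
  assert (r : forall l : Hom (times (coprod X) A) B, ev ∘ pair (cur l ∘ pr1) pr2 = l).
  { intros l; now rewrite ev_cur' pair_pr comp_idr. }
  rewrite -(r h) -(r k); do 3 f_equal.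
  apply coprod_ext; intros i; apply ev_ext; unfold tmap.
  rewrite !comp_idl -!comp_assoc !ev_cur'; apply e.
Qed.

Lemma caser_ext {I : small} {X : I -> V} {A B : V} (h k : Hom (times A (coprod X)) B) :
  (forall i, h ∘ pair pr1 (inj X i ∘ pr2) = k ∘ pair pr1 (inj X i ∘ pr2)) -> h = k.
Proof.
  intros e.
  assert (s : h ∘ swap = k ∘ swap).
  { apply casel_ext; intros i; unfold swap.
    rewrite -!comp_assoc !pair_comp !pr1_pair !pr2_pair.
    specialize (e i); apply (f_equal (fun l => l ∘ pair pr2 pr1)) in e.
    now rewrite -!comp_assoc !pair_comp -!comp_assoc !pr1_pair !pr2_pair in e. }
  apply (f_equal (fun l => l ∘ swap)) in s; unfold swap in s.
  now rewrite -!comp_assoc !pair_comp !pr1_pair !pr2_pair !pair_pr !comp_idr in s.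
Qed.

Lemma caser_ext2 {I : small} {X : I -> V} {A B C : V}
  (h k : Hom (times A (times B (coprod X))) C) :
  (forall i, h ∘ pair pr1 (pair (pr1 ∘ pr2) (inj X i ∘ (pr2 ∘ pr2))) =
             k ∘ pair pr1 (pair (pr1 ∘ pr2) (inj X i ∘ (pr2 ∘ pr2)))) -> h = k.
Proof.
  intros e.
  pose (r := pair (pr1 ∘ pr1) (pair (pr2 ∘ pr1) pr2)
        : Hom (times (times A B) (coprod X)) (times A (times B (coprod X)))).
  assert (s : h ∘ r = k ∘ r).
  { apply caser_ext; intros i; unfold r.
    specialize (e i).
    apply (f_equal (fun l => l ∘ pair (pr1 ∘ pr1) (pair (pr2 ∘ pr1) pr2))) in e.
    revert e. repeat rewrite ?pair_comp -?comp_assoc ?pr1_pair ?pr2_pair. auto. }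
  apply (f_equal (fun l => l ∘ pair (pair pr1 (pr1 ∘ pr2)) (pr2 ∘ pr2))) in s.
  revert s; unfold r.
  repeat rewrite ?pair_comp -?comp_assoc ?pr1_pair ?pr2_pair.
  now rewrite !pair_eta !pair_pr !comp_idr.
Qed.

Lemma casel_ext2 {I : small} {X : I -> V} {A B C : V}
  (h k : Hom (times A (times (coprod X) B)) C) :
  (forall i, h ∘ pair pr1 (pair (inj X i ∘ (pr1 ∘ pr2)) (pr2 ∘ pr2)) =
             k ∘ pair pr1 (pair (inj X i ∘ (pr1 ∘ pr2)) (pr2 ∘ pr2))) -> h = k.
Proof.
  intros e.
  pose (r := pair pr1 (pair (pr2 ∘ pr2) (pr1 ∘ pr2))
        : Hom (times A (times B (coprod X))) (times A (times (coprod X) B))).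
  assert (s : h ∘ r = k ∘ r).
  { apply caser_ext2; intros i; unfold r.
    specialize (e i).
    apply (f_equal (fun l => l ∘ pair pr1 (pair (pr2 ∘ pr2) (pr1 ∘ pr2)))) in e.
    revert e. repeat rewrite ?pair_comp -?comp_assoc ?pr1_pair ?pr2_pair. auto. }
  apply (f_equal (fun l => l ∘ pair pr1 (pair (pr2 ∘ pr2) (pr1 ∘ pr2)))) in s.
  revert s; unfold r.
  repeat rewrite ?pair_comp -?comp_assoc ?pr1_pair ?pr2_pair.
  now rewrite !pair_eta !pair_pr !comp_idr.
Qed.

End BaseOperations.

Arguments one {V}.
Arguments coprod_map {V I J X Y} u f.

#[global] Opaque one bang times pr1 pr2 pair pb pb1 pb2 pb_lift coprod inj copair
  casel caser.

(* Normalisation of composites: compositions associate to the right, pairings are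
   pushed outwards and projections and injections are cancelled. *)
Ltac cat_step :=
  match goal with
  | |- context [comp pb1 (@pb_lift _ _ _ _ _ _ _ _ _ ?e)] => rewrite (pb1_lift e)
  | |- context [comp pb2 (@pb_lift _ _ _ _ _ _ _ _ _ ?e)] => rewrite (pb2_lift e)
  | |- context [comp pb1 (comp (@pb_lift _ _ _ _ _ _ _ _ _ ?e) ?x)] =>
      rewrite (comp_assoc pb1 (pb_lift e) x) (pb1_lift e)
  | |- context [comp pb2 (comp (@pb_lift _ _ _ _ _ _ _ _ _ ?e) ?x)] =>
      rewrite (comp_assoc pb2 (pb_lift e) x) (pb2_lift e)
  | |- context [comp (comp ?h ?g) ?f] => rewrite -(comp_assoc h g f)
  | |- context [comp (idm ?A) ?f] => rewrite (comp_idl f)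
  | |- context [comp ?f (idm ?A)] => rewrite (comp_idr f)
  | |- context [comp (pair ?f ?g) ?h] => rewrite (pair_comp f g h)
  | |- context [comp pr1 (pair ?f ?g)] => rewrite (pr1_pair f g)
  | |- context [comp pr2 (pair ?f ?g)] => rewrite (pr2_pair f g)
  | |- context [pair pr1 pr2] => rewrite pair_pr
  | |- context [pair (comp pr1 ?h) (comp pr2 ?h)] => rewrite (pair_eta h)
  | |- context [comp (copair ?f) (inj ?X ?i)] => rewrite (copair_inj (X := X) f i)
  | |- context [comp (copair ?f) (comp (inj ?X ?i) ?x)] =>
      rewrite (comp_assoc (copair f) (inj X i) x) (copair_inj (X := X) f i)
  | |- context [comp (casel ?f) (pair (comp (inj ?X ?i) ?g) ?h)] =>
      rewrite (casel_inj (X := X) f (i := i) g h)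
  | |- context [comp (casel ?f) (pair (inj ?X ?i) ?h)] =>
      rewrite -(comp_idr (inj X i)); rewrite (casel_inj (X := X) f (i := i) (idm (X i)) h)
  | |- context [comp (caser ?f) (pair ?g (comp (inj ?X ?i) ?h))] =>
      rewrite (caser_inj (X := X) f (i := i) g h)
  | |- context [comp (caser ?f) (pair ?g (inj ?X ?i))] =>
      rewrite -(comp_idr (inj X i)); rewrite (caser_inj (X := X) f (i := i) g (idm (X i)))
  end; cbn.

Ltac cat_unfold := unfold tmap, coprod_map.

Ltac cat := cbn; cat_unfold; repeat (cat_step; cat_unfold); try reflexivity.

Section Extensive.
Context (V : BaseCategory).

Definition coprod_slice_ob (I : small) (X : I -> V) (A : forall i, slice (X i)) :
  slice (coprod X) :=
  {| so_dom := coprod (fun i => so_dom (A i));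
     so_map := coprod_map (fun i => i) (fun i => so_map (A i)) |}.

Definition coprod_slice (I : small) (X : I -> V) :
  Functor (prod_cat (fun i => slice (X i))) (slice (coprod X)).
Proof.
  unshelve refine (@Build_Functor (prod_cat (fun i => slice (X i))) (slice (coprod X))
    (@coprod_slice_ob I X)
    (fun A B f => @Build_SliceHom _ _ (coprod_slice_ob A) (coprod_slice_ob B)
      (coprod_map (fun i => i) (fun i => sh_map (f i))) _) _ _).
  - apply coprod_ext; intros i; unfold coprod_slice_ob; cbn; cat. now rewrite sh_comm.
  - intros A; apply slice_hom_eq, coprod_ext; intros i; unfold coprod_slice_ob; cbn; cat.
  - intros A B C g f; apply slice_hom_eq, coprod_ext; intros i; unfold coprod_slice_ob; cbn; cat.
Defined.

Definition extensive : Prop :=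
  forall (I : small) (X : I -> V), is_equivalence (coprod_slice X).

(* The object I • 1 and the map u • 1. *)
Definition disc (I : small) : V := coprod (fun _ : I => one).

Definition pt (I : small) (i : I) : Hom one (disc I) := inj (fun _ : I => one) i.

Definition disc_map (I J : small) (u : I -> J) : Hom (disc I) (disc J) :=
  copair (fun i => pt (u i)).

Definition family_total_ob (I : small) (X : I -> V) : slice (disc I) :=
  {| so_dom := coprod X; so_map := copair (fun i => pt i ∘ bang (X i)) |}.

Definition family_total (I : small) : Functor (power_cat V I) (slice (disc I)).
Proof.
  unshelve refine (@Build_Functor (power_cat V I) (slice (disc I))
    (@family_total_ob I)
    (fun X Y f => @Build_SliceHom _ _ (family_total_ob X) (family_total_ob Y)
      (coprod_map (fun i => i) f) _) _ _).
  - apply coprod_ext; intros i; unfold family_total_ob; cbn; cat. f_equal; apply one_uniq.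
  - intros A; apply slice_hom_eq, coprod_ext; intros i; unfold family_total_ob; cbn; cat.
  - intros A B C g f; apply slice_hom_eq, coprod_ext; intros i; unfold family_total_ob; cbn; cat.
Defined.

Lemma fibre_map_comm (I : small) (A B : slice (disc I)) (f : Hom A B) (i : I) :
  so_map B ∘ (sh_map f ∘ pb1) = pt i ∘ @pb2 _ _ _ _ (so_map A) (pt i).
Proof. now rewrite comp_assoc sh_comm pb_comm. Qed.

Definition slice_fibres (I : small) : Functor (slice (disc I)) (power_cat V I).
Proof.
  unshelve refine (@Build_Functor (slice (disc I)) (power_cat V I)
    (fun A i => pb (so_map A) (pt i))
    (fun A B f i => pb_lift (fibre_map_comm f i)) _ _).
  - intros A; apply functional_extensionality_dep; intros i; cbn.
    apply pb_ext; cat.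
  - intros A B C g f; apply functional_extensionality_dep; intros i; cbn.
    apply pb_ext; cat.
Defined.

Lemma family_unit_comm (I : small) (X : I -> V) (i : I) :
  copair (fun i => pt i ∘ bang (X i)) ∘ inj X i = pt i ∘ bang (X i).
Proof. cat. Qed.

Definition family_unit (I : small) :
  NatTrans (functor_id (power_cat V I)) (functor_comp (slice_fibres I) (family_total I)).
Proof.
  unshelve refine (@Build_NatTrans _ _ (functor_id (power_cat V I))
    (functor_comp (slice_fibres I) (family_total I))
    (fun X i => pb_lift (family_unit_comm X i)) _).
  intros X Y f; apply functional_extensionality_dep; intros i; cbn.
  apply pb_ext; cat. apply one_uniq.
Defined.

Definition family_counit (I : small) :
  NatTrans (functor_comp (family_total I) (slice_fibres I)) (functor_id (slice (disc I))).
Proof.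
  unshelve refine (@Build_NatTrans _ _ (functor_comp (family_total I) (slice_fibres I))
    (functor_id (slice (disc I)))
    (fun A => @Build_SliceHom _ _ (family_total_ob (slice_fibres I A)) A
      (copair (fun i => @pb1 _ _ _ _ (so_map A) (pt i))) _) _).
  - cbn; apply coprod_ext; intros i; cat. rewrite pb_comm; f_equal; apply one_uniq.
  - intros A B f; apply slice_hom_eq, coprod_ext; intros i; unfold family_total_ob; cbn; cat.
Defined.

Definition family_adjunction (I : small) : Adjunction (family_total I) (slice_fibres I).
Proof.
  refine {| adj_unit := family_unit I; adj_counit := family_counit I |}.
  - intros X; apply slice_hom_eq, coprod_ext; intros i; unfold family_total_ob; cbn; cat.
  - intros A; apply functional_extensionality_dep; intros i; cbn.
    apply pb_ext; cat. apply one_uniq.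
Defined.

End Extensive.

(* [vert] is the category of objects and vertical 1-cells.  The 2-cells carry
   their vertical boundary ([cell_l], [cell_r]) as data; horizontal composition of
   2-cells takes a proof that the boundaries match.  The laws below quantify over such
   proofs [e]; in each of them these proofs always exist. *)
Record DoubleData := {
  vert :> Category;
  Hor : vert -> vert -> Type;
  Cell : forall I J I' J', Hor I J -> Hor I' J' -> small;
  cell_l : forall I J I' J' (M : Hor I J) (N : Hor I' J'), Cell M N -> Hom I I';
  cell_r : forall I J I' J' (M : Hor I J) (N : Hor I' J'), Cell M N -> Hom J J';
  cell_id : forall I J (M : Hor I J), Cell M M;
  cell_comp : forall I J I' J' I'' J''
    (M : Hor I J) (N : Hor I' J') (P : Hor I'' J''), Cell N P -> Cell M N -> Cell M P;
  hid : forall I, Hor I I;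
  hid_cell : forall I J, Hom I J -> Cell (hid I) (hid J);
  hcomp : forall I J K, Hor I J -> Hor J K -> Hor I K;
  hcell : forall I J K I' J' K' (M : Hor I J) (N : Hor J K) (M' : Hor I' J')
    (N' : Hor J' K') (a : Cell M M') (b : Cell N N'),
    cell_r a = cell_l b -> Cell (hcomp M N) (hcomp M' N');
  hassoc : forall I J K L (M : Hor I J) (N : Hor J K) (P : Hor K L),
    Cell (hcomp (hcomp M N) P) (hcomp M (hcomp N P));
  hlun : forall I J (M : Hor I J), Cell (hcomp (hid I) M) M;
  hrun : forall I J (M : Hor I J), Cell (hcomp M (hid J)) M }.

Arguments Hor {d} _ _.
Arguments Cell {d I J I' J'} _ _.
Arguments cell_l {d I J I' J' M N} _.
Arguments cell_r {d I J I' J' M N} _.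
Arguments cell_id {d I J} M.
Arguments cell_comp {d I J I' J' I'' J'' M N P} _ _.
Arguments hid {d} I.
Arguments hid_cell {d I J} _.
Arguments hcomp {d I J K} _ _.
Arguments hcell {d I J K I' J' K' M N M' N'} a b _.
Arguments hassoc {d I J K L} M N P.
Arguments hlun {d I J} M.
Arguments hrun {d I J} M.

Notation "b ∙ a" := (cell_comp b a) (at level 40, left associativity) : cat_scope.
(* Horizontal composites are written in diagrammatic order. *)
Notation "M ⊙ N" := (hcomp M N) (at level 38, left associativity) : cat_scope.

Section PseudoDoubleLaws.
Context (D : DoubleData).

Definition globular (I J : D) (M N : Hor I J) (a : Cell M N) : Prop :=
  cell_l a = idm I /\ cell_r a = idm J.

Definition cell_is_iso (I J I' J' : D) (M : Hor I J) (N : Hor I' J') (a : Cell M N) : Prop :=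
  exists b : Cell N M, b ∙ a = cell_id M /\ a ∙ b = cell_id N.

Record CellCategoryLaws : Prop := {
  cell_assoc : forall (I J I' J' I'' J'' I3 J3 : D) (M : Hor I J) (N : Hor I' J')
    (P : Hor I'' J'') (Q : Hor I3 J3) (c : Cell P Q) (b : Cell N P) (a : Cell M N),
    c ∙ (b ∙ a) = (c ∙ b) ∙ a;
  cell_idl : forall (I J I' J' : D) (M : Hor I J) (N : Hor I' J') (a : Cell M N),
    cell_id N ∙ a = a;
  cell_idr : forall (I J I' J' : D) (M : Hor I J) (N : Hor I' J') (a : Cell M N),
    a ∙ cell_id M = a;
  cell_id_globular : forall (I J : D) (M : Hor I J), globular (cell_id M);
  cell_comp_l : forall (I J I' J' I'' J'' : D) (M : Hor I J) (N : Hor I' J')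
    (P : Hor I'' J'') (b : Cell N P) (a : Cell M N), cell_l (b ∙ a) = cell_l b ∘ cell_l a;
  cell_comp_r : forall (I J I' J' I'' J'' : D) (M : Hor I J) (N : Hor I' J')
    (P : Hor I'' J'') (b : Cell N P) (a : Cell M N), cell_r (b ∙ a) = cell_r b ∘ cell_r a }.

Record HorizontalFunctorLaws : Prop := {
  hid_cell_l : forall (I J : D) (u : Hom I J), cell_l (hid_cell u) = u;
  hid_cell_r : forall (I J : D) (u : Hom I J), cell_r (hid_cell u) = u;
  hid_cell_id : forall I : D, hid_cell (idm I) = cell_id (hid I);
  hid_cell_comp : forall (I J K : D) (v : Hom J K) (u : Hom I J),
    hid_cell (v ∘ u) = hid_cell v ∙ hid_cell u;
  hcell_l : forall (I J K I' J' K' : D) (M : Hor I J) (N : Hor J K) (M' : Hor I' J')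
    (N' : Hor J' K') (a : Cell M M') (b : Cell N N') e, cell_l (hcell a b e) = cell_l a;
  hcell_r : forall (I J K I' J' K' : D) (M : Hor I J) (N : Hor J K) (M' : Hor I' J')
    (N' : Hor J' K') (a : Cell M M') (b : Cell N N') e, cell_r (hcell a b e) = cell_r b;
  hcell_id : forall (I J K : D) (M : Hor I J) (N : Hor J K) e,
    hcell (cell_id M) (cell_id N) e = cell_id (M ⊙ N);
  hcell_comp : forall (I J K I' J' K' I'' J'' K'' : D) (M : Hor I J) (N : Hor J K)
    (M' : Hor I' J') (N' : Hor J' K') (M'' : Hor I'' J'') (N'' : Hor J'' K'')
    (a' : Cell M' M'') (b' : Cell N' N'') (a : Cell M M') (b : Cell N N') e e' e'',
    hcell (a' ∙ a) (b' ∙ b) e'' = hcell a' b' e' ∙ hcell a b e }.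

Record CoherenceLaws : Prop := {
  hassoc_globular : forall (I J K L : D) (M : Hor I J) (N : Hor J K) (P : Hor K L),
    globular (hassoc M N P);
  hlun_globular : forall (I J : D) (M : Hor I J), globular (hlun M);
  hrun_globular : forall (I J : D) (M : Hor I J), globular (hrun M);
  hassoc_iso : forall (I J K L : D) (M : Hor I J) (N : Hor J K) (P : Hor K L),
    cell_is_iso (hassoc M N P);
  hlun_iso : forall (I J : D) (M : Hor I J), cell_is_iso (hlun M);
  hrun_iso : forall (I J : D) (M : Hor I J), cell_is_iso (hrun M);
  hassoc_nat : forall (I J K L I' J' K' L' : D) (M : Hor I J) (N : Hor J K) (P : Hor K L)
    (M' : Hor I' J') (N' : Hor J' K') (P' : Hor K' L')
    (a : Cell M M') (b : Cell N N') (c : Cell P P') e1 e2 e3 e4,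
    hassoc M' N' P' ∙ hcell (hcell a b e1) c e2
    = hcell a (hcell b c e3) e4 ∙ hassoc M N P;
  hlun_nat : forall (I J I' J' : D) (M : Hor I J) (M' : Hor I' J') (a : Cell M M') e,
    hlun M' ∙ hcell (hid_cell (cell_l a)) a e = a ∙ hlun M;
  hrun_nat : forall (I J I' J' : D) (M : Hor I J) (M' : Hor I' J') (a : Cell M M') e,
    hrun M' ∙ hcell a (hid_cell (cell_r a)) e = a ∙ hrun M;
  pentagon : forall (I J K L O : D) (M : Hor I J) (N : Hor J K) (P : Hor K L)
    (Q : Hor L O) e1 e2,
    hassoc M N (P ⊙ Q) ∙ hassoc (M ⊙ N) P Q
    = hcell (cell_id M) (hassoc N P Q) e1 ∙
      (hassoc M (N ⊙ P) Q ∙ hcell (hassoc M N P) (cell_id Q) e2);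
  triangle : forall (I J K : D) (M : Hor I J) (N : Hor J K) e1 e2,
    hcell (cell_id M) (hlun N) e1 ∙ hassoc M (hid J) N
    = hcell (hrun M) (cell_id N) e2 }.

End PseudoDoubleLaws.

Record PseudoDouble := {
  pd_data :> DoubleData;
  pd_cells : CellCategoryLaws pd_data;
  pd_horizontal : HorizontalFunctorLaws pd_data;
  pd_coherence : CoherenceLaws pd_data }.

Record DoubleMap (D E : DoubleData) := {
  dm_vert : Functor D E;
  dm_hor : forall I J : D, Hor I J -> Hor (dm_vert I) (dm_vert J);
  dm_cell : forall (I J I' J' : D) (M : Hor I J) (N : Hor I' J'),
    Cell M N -> Cell (dm_hor M) (dm_hor N);
  dm_cell_l : forall (I J I' J' : D) (M : Hor I J) (N : Hor I' J') (a : Cell M N),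
    cell_l (dm_cell a) = fmap dm_vert (cell_l a);
  dm_cell_r : forall (I J I' J' : D) (M : Hor I J) (N : Hor I' J') (a : Cell M N),
    cell_r (dm_cell a) = fmap dm_vert (cell_r a);
  dm_cell_id : forall (I J : D) (M : Hor I J),
    dm_cell (cell_id M) = cell_id (dm_hor M);
  dm_cell_comp : forall (I J I' J' I'' J'' : D) (M : Hor I J) (N : Hor I' J')
    (P : Hor I'' J'') (b : Cell N P) (a : Cell M N),
    dm_cell (b ∙ a) = dm_cell b ∙ dm_cell a }.

Arguments dm_vert {D E} _.
Arguments dm_hor {D E} _ {I J} _.
Arguments dm_cell {D E} _ {I J I' J' M N} _.

Definition double_map_id (D : DoubleData) : DoubleMap D D.
Proof.
  refine {| dm_vert := functor_id D; dm_hor := fun I J M => M;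
            dm_cell := fun I J I' J' M N a => a |}; reflexivity.
Defined.

Definition double_map_comp (D E F : DoubleData) (T : DoubleMap E F) (S : DoubleMap D E) :
  DoubleMap D F.
Proof.
  refine {| dm_vert := functor_comp (dm_vert T) (dm_vert S);
            dm_hor := fun I J M => dm_hor T (dm_hor S M);
            dm_cell := fun I J I' J' M N a => dm_cell T (dm_cell S a) |}; intros.
  - now rewrite !dm_cell_l.
  - now rewrite !dm_cell_r.
  - now rewrite !dm_cell_id.
  - now rewrite !dm_cell_comp.
Defined.

(* Comparison 2-cells; lax and oplax double functors differ in their direction. *)
Record LaxCells (D E : DoubleData) (F : DoubleMap D E) := {
  lax_comp : forall (I J K : D) (M : Hor I J) (N : Hor J K),
    Cell (dm_hor F M ⊙ dm_hor F N) (dm_hor F (M ⊙ N));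
  lax_unit : forall I : D, Cell (hid (dm_vert F I)) (dm_hor F (hid I)) }.

Arguments lax_comp {D E F} _ {I J K} M N.
Arguments lax_unit {D E F} _ I.

Record OplaxCells (D E : DoubleData) (F : DoubleMap D E) := {
  oplax_comp : forall (I J K : D) (M : Hor I J) (N : Hor J K),
    Cell (dm_hor F (M ⊙ N)) (dm_hor F M ⊙ dm_hor F N);
  oplax_unit : forall I : D, Cell (dm_hor F (hid I)) (hid (dm_vert F I)) }.

Arguments oplax_comp {D E F} _ {I J K} M N.
Arguments oplax_unit {D E F} _ I.

Record LaxLaws (D E : DoubleData) (F : DoubleMap D E) (p : LaxCells F) : Prop := {
  lax_comp_globular : forall (I J K : D) (M : Hor I J) (N : Hor J K),
    globular (lax_comp p M N);
  lax_unit_globular : forall I : D, globular (lax_unit p I);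
  lax_comp_nat : forall (I J K I' J' K' : D) (M : Hor I J) (N : Hor J K)
    (M' : Hor I' J') (N' : Hor J' K') (a : Cell M M') (b : Cell N N') e e',
    dm_cell F (hcell a b e) ∙ lax_comp p M N
    = lax_comp p M' N' ∙ hcell (dm_cell F a) (dm_cell F b) e';
  lax_unit_nat : forall (I J : D) (u : Hom I J),
    dm_cell F (hid_cell u) ∙ lax_unit p I = lax_unit p J ∙ hid_cell (fmap (dm_vert F) u);
  lax_assoc : forall (I J K L : D) (M : Hor I J) (N : Hor J K) (P : Hor K L) e1 e2,
    dm_cell F (hassoc M N P) ∙
      (lax_comp p (M ⊙ N) P ∙ hcell (lax_comp p M N) (cell_id (dm_hor F P)) e1)
    = lax_comp p M (N ⊙ P) ∙
      (hcell (cell_id (dm_hor F M)) (lax_comp p N P) e2 ∙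
        hassoc (dm_hor F M) (dm_hor F N) (dm_hor F P));
  lax_lun : forall (I J : D) (M : Hor I J) e,
    dm_cell F (hlun M) ∙
      (lax_comp p (hid I) M ∙ hcell (lax_unit p I) (cell_id (dm_hor F M)) e)
    = hlun (dm_hor F M);
  lax_run : forall (I J : D) (M : Hor I J) e,
    dm_cell F (hrun M) ∙
      (lax_comp p M (hid J) ∙ hcell (cell_id (dm_hor F M)) (lax_unit p J) e)
    = hrun (dm_hor F M) }.

Record OplaxLaws (D E : DoubleData) (F : DoubleMap D E) (p : OplaxCells F) : Prop := {
  oplax_comp_globular : forall (I J K : D) (M : Hor I J) (N : Hor J K),
    globular (oplax_comp p M N);
  oplax_unit_globular : forall I : D, globular (oplax_unit p I);
  oplax_comp_nat : forall (I J K I' J' K' : D) (M : Hor I J) (N : Hor J K)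
    (M' : Hor I' J') (N' : Hor J' K') (a : Cell M M') (b : Cell N N') e e',
    hcell (dm_cell F a) (dm_cell F b) e' ∙ oplax_comp p M N
    = oplax_comp p M' N' ∙ dm_cell F (hcell a b e);
  oplax_unit_nat : forall (I J : D) (u : Hom I J),
    hid_cell (fmap (dm_vert F) u) ∙ oplax_unit p I
    = oplax_unit p J ∙ dm_cell F (hid_cell u);
  oplax_assoc : forall (I J K L : D) (M : Hor I J) (N : Hor J K) (P : Hor K L) e1 e2,
    hassoc (dm_hor F M) (dm_hor F N) (dm_hor F P) ∙
      (hcell (oplax_comp p M N) (cell_id (dm_hor F P)) e1 ∙ oplax_comp p (M ⊙ N) P)
    = hcell (cell_id (dm_hor F M)) (oplax_comp p N P) e2 ∙
      (oplax_comp p M (N ⊙ P) ∙ dm_cell F (hassoc M N P));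
  oplax_lun : forall (I J : D) (M : Hor I J) e,
    hlun (dm_hor F M) ∙
      (hcell (oplax_unit p I) (cell_id (dm_hor F M)) e ∙ oplax_comp p (hid I) M)
    = dm_cell F (hlun M);
  oplax_run : forall (I J : D) (M : Hor I J) e,
    hrun (dm_hor F M) ∙
      (hcell (cell_id (dm_hor F M)) (oplax_unit p J) e ∙ oplax_comp p M (hid J))
    = dm_cell F (hrun M) }.

Record LaxDoubleFunctor (D E : PseudoDouble) := {
  lax_map :> DoubleMap D E;
  lax_cells : LaxCells lax_map;
  lax_laws : LaxLaws lax_cells }.

Record OplaxDoubleFunctor (D E : PseudoDouble) := {
  oplax_map :> DoubleMap D E;
  oplax_cells : OplaxCells oplax_map;
  oplax_laws : OplaxLaws oplax_cells }.

Definition lax_cells_id (D : DoubleData) : LaxCells (double_map_id D) :=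
  @Build_LaxCells D D (double_map_id D)
    (fun I J K M N => cell_id (M ⊙ N)) (fun I => cell_id (hid I)).

Definition oplax_cells_id (D : DoubleData) : OplaxCells (double_map_id D) :=
  @Build_OplaxCells D D (double_map_id D)
    (fun I J K M N => cell_id (M ⊙ N)) (fun I => cell_id (hid I)).

Definition lax_cells_comp (D E F : DoubleData) (T : DoubleMap E F) (S : DoubleMap D E)
  (q : LaxCells T) (p : LaxCells S) : LaxCells (double_map_comp T S) :=
  @Build_LaxCells D F (double_map_comp T S)
    (fun I J K M N => dm_cell T (lax_comp p M N) ∙ lax_comp q (dm_hor S M) (dm_hor S N))
    (fun I => dm_cell T (lax_unit p I) ∙ lax_unit q (dm_vert S I)).

Definition oplax_cells_comp (D E F : DoubleData) (T : DoubleMap E F) (S : DoubleMap D E)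
  (q : OplaxCells T) (p : OplaxCells S) : OplaxCells (double_map_comp T S) :=
  @Build_OplaxCells D F (double_map_comp T S)
    (fun I J K M N => oplax_comp q (dm_hor S M) (dm_hor S N) ∙ dm_cell T (oplax_comp p M N))
    (fun I => oplax_unit q (dm_vert S I) ∙ dm_cell T (oplax_unit p I)).

Record VertTrans (D E : DoubleData) (F G : DoubleMap D E) := {
  vt_vert : NatTrans (dm_vert F) (dm_vert G);
  vt_hor : forall (I J : D) (M : Hor I J), Cell (dm_hor F M) (dm_hor G M);
  vt_hor_l : forall (I J : D) (M : Hor I J), cell_l (vt_hor M) = vt_vert I;
  vt_hor_r : forall (I J : D) (M : Hor I J), cell_r (vt_hor M) = vt_vert J;
  vt_nat : forall (I J I' J' : D) (M : Hor I J) (N : Hor I' J') (a : Cell M N),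
    vt_hor N ∙ dm_cell F a = dm_cell G a ∙ vt_hor M }.

Arguments vt_vert {D E F G} _.
Arguments vt_hor {D E F G} _ {I J} M.

Definition vt_invertible (D E : DoubleData) (F G : DoubleMap D E) (t : VertTrans F G) : Prop :=
  nat_iso (vt_vert t) /\ forall (I J : D) (M : Hor I J), cell_is_iso (vt_hor t M).

Definition lax_compatible (D E : DoubleData) (F G : DoubleMap D E) (p : LaxCells F)
    (q : LaxCells G) (t : VertTrans F G) : Prop :=
  (forall (I J K : D) (M : Hor I J) (N : Hor J K) e,
    vt_hor t (M ⊙ N) ∙ lax_comp p M N = lax_comp q M N ∙ hcell (vt_hor t M) (vt_hor t N) e) /\
  (forall I : D, vt_hor t (hid I) ∙ lax_unit p I = lax_unit q I ∙ hid_cell (vt_vert t I)).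

Definition oplax_compatible (D E : DoubleData) (F G : DoubleMap D E) (p : OplaxCells F)
    (q : OplaxCells G) (t : VertTrans F G) : Prop :=
  (forall (I J K : D) (M : Hor I J) (N : Hor J K) e,
    hcell (vt_hor t M) (vt_hor t N) e ∙ oplax_comp p M N = oplax_comp q M N ∙ vt_hor t (M ⊙ N)) /\
  (forall I : D, hid_cell (vt_vert t I) ∙ oplax_unit p I = oplax_unit q I ∙ vt_hor t (hid I)).

(* Equivalences in the 2-categories of pseudo-double categories, (op)lax double
   functors and vertical transformations.  By doctrinal adjunction the comparison cells of
   such an equivalence are automatically invertible. *)

Definition lax_double_equivalence (D E : PseudoDouble) (F : LaxDoubleFunctor D E) : Prop :=
  exists (G : LaxDoubleFunctor E D)
    (eta : VertTrans (double_map_id D) (double_map_comp G F))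
    (eps : VertTrans (double_map_comp F G) (double_map_id E)),
    (vt_invertible eta /\
     lax_compatible (lax_cells_id D) (lax_cells_comp (lax_cells G) (lax_cells F)) eta) /\
    (vt_invertible eps /\
     lax_compatible (lax_cells_comp (lax_cells F) (lax_cells G)) (lax_cells_id E) eps).

Definition oplax_double_equivalence (D E : PseudoDouble) (F : OplaxDoubleFunctor D E) : Prop :=
  exists (G : OplaxDoubleFunctor E D)
    (eta : VertTrans (double_map_id D) (double_map_comp G F))
    (eps : VertTrans (double_map_comp F G) (double_map_id E)),
    (vt_invertible eta /\
     oplax_compatible (oplax_cells_id D) (oplax_cells_comp (oplax_cells G) (oplax_cells F)) eta) /\
    (vt_invertible eps /\
     oplax_compatible (oplax_cells_comp (oplax_cells F) (oplax_cells G)) (oplax_cells_id E) eps).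

Section Matrices.
Context (V : BaseCategory).

Definition Mat (I J : small) : Type := I -> J -> V.

Record MatCell (I J I' J' : small) (M : Mat I J) (N : Mat I' J') := {
  mc_l : I -> I';
  mc_r : J -> J';
  mc_map : forall i j, Hom (M i j) (N (mc_l i) (mc_r j)) }.

Lemma mat_cell_eq (I J I' J' : small) (M : Mat I J) (N : Mat I' J') (u : I -> I')
  (v : J -> J') (f g : forall i j, Hom (M i j) (N (u i) (v j))) :
  (forall i j, f i j = g i j) ->
  {| mc_l := u; mc_r := v; mc_map := f |} = {| mc_l := u; mc_r := v; mc_map := g |}.
Proof.
  intros e; f_equal.
  apply functional_extensionality_dep; intros i.
  apply functional_extensionality_dep; intros j; apply e.
Qed.

Definition mat_cell_id (I J : small) (M : Mat I J) : MatCell M M :=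
  {| mc_l := fun i => i; mc_r := fun j => j; mc_map := fun i j => idm (M i j) |}.

Definition mat_cell_comp (I J I' J' I'' J'' : small) (M : Mat I J) (N : Mat I' J')
    (P : Mat I'' J'') (b : MatCell N P) (a : MatCell M N) : MatCell M P :=
  {| mc_l := fun i => mc_l b (mc_l a i); mc_r := fun j => mc_r b (mc_r a j);
     mc_map := fun i j => mc_map b (mc_l a i) (mc_r a j) ∘ mc_map a i j |}.

(* The unit matrix: a copy of 1 for each proof of [i = j], that is 1 on the diagonal
   and the initial object elsewhere. *)
Definition mat_id (I : small) : Mat I I := fun i j => coprod (fun _ : i = j => one).

Arguments mat_id I : clear implicits.

Definition mat_id_cell (I J : small) (u : I -> J) : MatCell (mat_id I) (mat_id J) :=
  {| mc_l := u; mc_r := u;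
     mc_map := fun i j => copair (fun e : i = j =>
       inj (fun _ : u i = u j => one) (f_equal u e)) |}.

Definition mat_term (I J K : small) (M : Mat I J) (N : Mat J K) (i : I) (k : K) (j : J) : V :=
  times (N j k) (M i j).

Definition mat_comp (I J K : small) (M : Mat I J) (N : Mat J K) : Mat I K :=
  fun i k => coprod (mat_term M N i k).

Definition mat_cell_hcomp_map (I J K I' J' K' : small) (M : Mat I J) (N : Mat J K)
  (M' : Mat I' J') (N' : Mat J' K') (u : I -> I') (v : J -> J') (w : K -> K')
  (f : forall i j, Hom (M i j) (M' (u i) (v j)))
  (g : forall j k, Hom (N j k) (N' (v j) (w k))) (i : I) (k : K) :
  Hom (mat_comp M N i k) (mat_comp M' N' (u i) (w k)) :=
  copair (X := mat_term M N i k)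
    (fun j => inj (mat_term M' N' (u i) (w k)) (v j) ∘ tmap (g j k) (f i j)).

Definition mat_cell_hcomp (I J K I' J' K' : small) (M : Mat I J) (N : Mat J K)
  (M' : Mat I' J') (N' : Mat J' K') (a : MatCell M M') (b : MatCell N N')
  (e : mc_r a = mc_l b) : MatCell (mat_comp M N) (mat_comp M' N') :=
  {| mc_l := mc_l a; mc_r := mc_r b;
     mc_map := mat_cell_hcomp_map (mc_map a)
       (eq_rect_r (fun v => forall j k, Hom (N j k) (N' (v j) (mc_r b k))) (mc_map b) e) |}.

Lemma mat_cell_hcompE (I J K I' J' K' : small) (M : Mat I J) (N : Mat J K)
  (M' : Mat I' J') (N' : Mat J' K') (u : I -> I') (v : J -> J') (w : K -> K')
  (f : forall i j, Hom (M i j) (M' (u i) (v j)))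
  (g : forall j k, Hom (N j k) (N' (v j) (w k))) e :
  @mat_cell_hcomp I J K I' J' K' M N M' N'
    {| mc_l := u; mc_r := v; mc_map := f |} {| mc_l := v; mc_r := w; mc_map := g |} e
  = {| mc_l := u; mc_r := w; mc_map := mat_cell_hcomp_map f g |}.
Proof. cbn in e. now rewrite (proof_irrelevance _ e eq_refl). Qed.

Definition mat_assoc_map (I J K L : small) (M : Mat I J) (N : Mat J K) (P : Mat K L) i l :
  Hom (mat_comp (mat_comp M N) P i l) (mat_comp M (mat_comp N P) i l) :=
  copair (X := mat_term (mat_comp M N) P i l) (fun k =>
    caser (X := mat_term M N i k) (fun j =>
      inj (mat_term M (mat_comp N P) i l) j ∘
        pair (inj (mat_term N P j l) k ∘ pair pr1 (pr1 ∘ pr2)) (pr2 ∘ pr2))).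

Definition mat_assoc_inv (I J K L : small) (M : Mat I J) (N : Mat J K) (P : Mat K L) i l :
  Hom (mat_comp M (mat_comp N P) i l) (mat_comp (mat_comp M N) P i l) :=
  copair (X := mat_term M (mat_comp N P) i l) (fun j =>
    casel (X := mat_term N P j l) (fun k =>
      inj (mat_term (mat_comp M N) P i l) k ∘
        pair (pr1 ∘ pr1) (inj (mat_term M N i k) j ∘ pair (pr2 ∘ pr1) pr2))).

Definition mat_lun_map (I J : small) (M : Mat I J) i j :
  Hom (mat_comp (mat_id I) M i j) (M i j) :=
  copair (X := mat_term (mat_id I) M i j) (fun i' =>
    caser (X := fun _ : i = i' => one) (fun e =>
      match e in _ = i' return Hom (times (M i' j) one) (M i j) with
      | eq_refl => pr1 end)).

Definition mat_lun_inv (I J : small) (M : Mat I J) i j :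
  Hom (M i j) (mat_comp (mat_id I) M i j) :=
  inj (mat_term (mat_id I) M i j) i ∘
    pair (idm (M i j)) (inj (fun _ : i = i => one) eq_refl ∘ bang (M i j)).

Definition mat_run_map (I J : small) (M : Mat I J) i j :
  Hom (mat_comp M (mat_id J) i j) (M i j) :=
  copair (X := mat_term M (mat_id J) i j) (fun j' =>
    casel (X := fun _ : j' = j => one) (fun e =>
      match e in _ = j return Hom (times one (M i j')) (M i j) with
      | eq_refl => pr2 end)).

Definition mat_run_inv (I J : small) (M : Mat I J) i j :
  Hom (M i j) (mat_comp M (mat_id J) i j) :=
  inj (mat_term M (mat_id J) i j) j ∘
    pair (inj (fun _ : j = j => one) eq_refl ∘ bang (M i j)) (idm (M i j)).

Definition mat_data : DoubleData :=
  {| vert := SetCat;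
     Hor := Mat : SetCat -> SetCat -> Type;
     Cell := MatCell;
     cell_l := mc_l;
     cell_r := mc_r;
     cell_id := mat_cell_id;
     cell_comp := mat_cell_comp;
     hid := mat_id;
     hid_cell := mat_id_cell;
     hcomp := mat_comp;
     hcell := mat_cell_hcomp;
     hassoc := fun I J K L M N P =>
       {| mc_l := fun i => i; mc_r := fun l => l; mc_map := mat_assoc_map M N P |};
     hlun := fun I J M =>
       {| mc_l := fun i => i; mc_r := fun j => j; mc_map := mat_lun_map M |};
     hrun := fun I J M =>
       {| mc_l := fun i => i; mc_r := fun j => j; mc_map := mat_run_map M |} |}.

Lemma mat_cell_laws : CellCategoryLaws mat_data.
Proof.
  split; try reflexivity.
  - intros; apply mat_cell_eq; intros i j; apply comp_assoc.
  - intros I J I' J' M N [u v f]; apply mat_cell_eq; intros i j; apply comp_idl.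
  - intros I J I' J' M N [u v f]; apply mat_cell_eq; intros i j; apply comp_idr.
  - split; reflexivity.
Qed.

Ltac cat_unfold ::=
  unfold mat_cell_hcomp_map, mat_assoc_map, mat_assoc_inv, mat_lun_map, mat_lun_inv,
    mat_run_map, mat_run_inv, mat_cell_comp, mat_cell_id, mat_id_cell, eq_rect_r, tmap;
  cbn.

Lemma mat_horizontal_laws : HorizontalFunctorLaws mat_data.
Proof.
  split; try reflexivity.
  - intros I; apply mat_cell_eq; intros i j. apply coprod_ext; intros e; cat.
    destruct e; reflexivity.
  - intros I J K v u; apply mat_cell_eq; intros i j. apply coprod_ext; intros e; cat.
    destruct e; reflexivity.
  - intros I J K M N e.
    etransitivity; [apply (@mat_cell_hcompE _ _ _ _ _ _ M N M N)|].
    apply mat_cell_eq; intros i k. apply coprod_ext; intros j. cat.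
  - intros I J K I' J' K' I'' J'' K'' M N M' N' M'' N'' [u' v' f'] [v2' w' g'] [u v f]
      [v2 w g] e e' e''. cbn in e, e'. subst v2 v2'.
    etransitivity; [apply (@mat_cell_hcompE _ _ _ _ _ _ M N M'' N'')|].
    cbn [hcell cell_comp mat_data]. rewrite !mat_cell_hcompE.
    apply mat_cell_eq; intros i k. apply coprod_ext; intros j. cat.
Qed.

Ltac eq_refl_subst e :=
  let H := fresh in assert (H : e = eq_refl) by apply proof_irrelevance; subst e.

Lemma mat_coherence_laws : CoherenceLaws mat_data.
Proof.
  split.
  - split; reflexivity.
  - split; reflexivity.
  - split; reflexivity.
  - intros I J K L M N P.
    exists (@Build_MatCell _ _ _ _ (mat_comp M (mat_comp N P)) (mat_comp (mat_comp M N) P)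
      (fun i => i) (fun l => l) (mat_assoc_inv M N P)); split;
      apply mat_cell_eq; intros i l.
    + apply coprod_ext; intros k; cat. apply caser_ext; intros j; cat.
    + apply coprod_ext; intros j; cat. apply casel_ext; intros k; cat.
  - intros I J M.
    exists (@Build_MatCell _ _ _ _ M (mat_comp (mat_id I) M)
      (fun i => i) (fun l => l) (mat_lun_inv M)); split;
      apply mat_cell_eq; intros i j.
    + apply coprod_ext; intros i'; cat. apply caser_ext; intros e; cat.
      destruct e; cat. do 2 f_equal. f_equal. apply one_uniq.
    + cat.
  - intros I J M.
    exists (@Build_MatCell _ _ _ _ M (mat_comp M (mat_id J))
      (fun i => i) (fun l => l) (mat_run_inv M)); split;
      apply mat_cell_eq; intros i j.
    + apply coprod_ext; intros i'; cat. apply casel_ext; intros e; cat.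
      destruct e; cat. do 3 f_equal. apply one_uniq.
    + cat.
  - intros I J K L I' J' K' L' M N P M' N' P' [u v f] [v2 w g] [w2 x h] e1 e2 e3 e4.
    cbn in e1, e3; subst v2 w2; eq_refl_subst e2; eq_refl_subst e4.
    apply mat_cell_eq; intros i l; cat_unfold.
    apply coprod_ext; intros k; cat. apply caser_ext; intros j; cat.
  - intros I J I' J' M M' [u v f] e. eq_refl_subst e.
    apply mat_cell_eq; intros i j; cat_unfold.
    apply coprod_ext; intros i'; cat. apply caser_ext; intros e; cat. destruct e; cat.
  - intros I J I' J' M M' [u v f] e. eq_refl_subst e.
    apply mat_cell_eq; intros i j; cat_unfold.
    apply coprod_ext; intros i'; cat. apply casel_ext; intros e; cat. destruct e; cat.
  - intros I J K L O M N P Q e1 e2. eq_refl_subst e1; eq_refl_subst e2.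
    apply mat_cell_eq; intros i l; cat_unfold.
    apply coprod_ext; intros k; cat. apply caser_ext; intros j; cat.
    apply (caser_ext2 (X := mat_term M N i j)); intros j'; cat.
  - intros I J K M N e1 e2. eq_refl_subst e1; eq_refl_subst e2.
    apply mat_cell_eq; intros i l; cat_unfold.
    apply coprod_ext; intros k; cat. apply caser_ext; intros j; cat.
    apply (casel_ext2 (X := fun _ : j = k => one)); intros e; cat. destruct e; cat.
Qed.

Definition mat_double : PseudoDouble :=
  {| pd_cells := mat_cell_laws; pd_horizontal := mat_horizontal_laws;
     pd_coherence := mat_coherence_laws |}.

End Matrices.

Arguments mat_id V I : clear implicits.

Section Spans.
Context (V : BaseCategory).

Record Span (I J : small) := {
  sp_ob : V;
  sp_l : Hom sp_ob (disc V I);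
  sp_r : Hom sp_ob (disc V J) }.

Record SpanCell (I J I' J' : small) (A : Span I J) (B : Span I' J') := {
  sc_l : I -> I';
  sc_r : J -> J';
  sc_map : Hom (sp_ob A) (sp_ob B);
  sc_comm_l : sp_l B ∘ sc_map = disc_map V sc_l ∘ sp_l A;
  sc_comm_r : sp_r B ∘ sc_map = disc_map V sc_r ∘ sp_r A }.

Lemma span_cell_eq (I J I' J' : small) (A : Span I J) (B : Span I' J') (a b : SpanCell A B) :
  sc_l a = sc_l b -> sc_r a = sc_r b -> sc_map a = sc_map b -> a = b.
Proof.
  destruct a as [u v f e1 e2], b as [u' v' f' e1' e2']; cbn; intros; subst u' v' f'.
  f_equal; apply proof_irrelevance.
Qed.

Lemma disc_map_id (I : small) : disc_map V (fun i : I => i) = idm (disc V I).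
Proof. apply coprod_ext; intros i; unfold disc_map, pt; cat. Qed.

Lemma disc_map_comp (I J K : small) (v : J -> K) (u : I -> J) :
  disc_map V (fun i => v (u i)) = disc_map V v ∘ disc_map V u.
Proof. apply coprod_ext; intros i; unfold disc_map, pt; cat. Qed.

Definition span_cell_id (I J : small) (A : Span I J) : SpanCell A A.
Proof.
  refine {| sc_l := fun i => i; sc_r := fun j => j; sc_map := idm (sp_ob A) |};
  now rewrite disc_map_id comp_idl comp_idr.
Defined.

Definition span_cell_comp (I J I' J' I'' J'' : small) (A : Span I J) (B : Span I' J')
  (C : Span I'' J'') (b : SpanCell B C) (a : SpanCell A B) : SpanCell A C.
Proof.
  refine {| sc_l := fun i => sc_l b (sc_l a i); sc_r := fun j => sc_r b (sc_r a j);
            sc_map := sc_map b ∘ sc_map a |};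
  rewrite comp_assoc disc_map_comp.
  - now rewrite sc_comm_l -!comp_assoc sc_comm_l.
  - now rewrite sc_comm_r -!comp_assoc sc_comm_r.
Defined.

Definition span_id (I : small) : Span I I :=
  {| sp_ob := disc V I; sp_l := idm (disc V I); sp_r := idm (disc V I) |}.

Definition span_id_cell (I J : small) (u : I -> J) : SpanCell (span_id I) (span_id J).
Proof.
  refine (@Build_SpanCell _ _ _ _ (span_id I) (span_id J) u u (disc_map V u) _ _);
  cbn; now rewrite comp_idl comp_idr.
Defined.

Definition span_comp (I J K : small) (A : Span I J) (B : Span J K) : Span I K :=
  {| sp_ob := pb (sp_r A) (sp_l B); sp_l := sp_l A ∘ pb1; sp_r := sp_r B ∘ pb2 |}.

Lemma span_cell_hcomp_comm (I J K I' J' K' : small) (A : Span I J) (B : Span J K)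
  (A' : Span I' J') (B' : Span J' K') (a : SpanCell A A') (b : SpanCell B B')
  (e : sc_r a = sc_l b) :
  sp_r A' ∘ (sc_map a ∘ pb1) = sp_l B' ∘ (sc_map b ∘ @pb2 _ _ _ _ (sp_r A) (sp_l B)).
Proof.
  rewrite !comp_assoc sc_comm_l sc_comm_r e -!comp_assoc. now rewrite pb_comm.
Qed.

Definition span_cell_hcomp (I J K I' J' K' : small) (A : Span I J) (B : Span J K)
  (A' : Span I' J') (B' : Span J' K') (a : SpanCell A A') (b : SpanCell B B')
  (e : sc_r a = sc_l b) : SpanCell (span_comp A B) (span_comp A' B').
Proof.
  refine (@Build_SpanCell _ _ _ _ (span_comp A B) (span_comp A' B') (sc_l a) (sc_r b)
    (pb_lift (span_cell_hcomp_comm e)) _ _); cbn.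
  - now rewrite -comp_assoc pb1_lift !comp_assoc sc_comm_l.
  - now rewrite -comp_assoc pb2_lift !comp_assoc sc_comm_r.
Defined.

Section Associator.
Context (I J K L : small) (A : Span I J) (B : Span J K) (C : Span K L).

Lemma span_assoc_comm2 :
  sp_r B ∘ (pb2 ∘ pb1) = sp_l C ∘ @pb2 _ _ _ _ (sp_r (span_comp A B)) (sp_l C).
Proof. now rewrite comp_assoc -pb_comm. Qed.

Lemma span_assoc_comm1 :
  sp_r A ∘ (pb1 ∘ pb1) = sp_l (span_comp B C) ∘ pb_lift span_assoc_comm2.
Proof. cbn. now rewrite -comp_assoc pb1_lift !comp_assoc pb_comm. Qed.

Definition span_assoc : SpanCell (span_comp (span_comp A B) C) (span_comp A (span_comp B C)).
Proof.
  refine (@Build_SpanCell _ _ _ _ (span_comp (span_comp A B) C)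
    (span_comp A (span_comp B C)) (fun i => i) (fun l => l) (pb_lift span_assoc_comm1) _ _);
  rewrite disc_map_id comp_idl; cbn.
  - now rewrite -!comp_assoc pb1_lift.
  - now rewrite -!comp_assoc pb2_lift pb2_lift.
Defined.

Lemma span_assoc_inv_comm1 :
  sp_r A ∘ pb1 = sp_l B ∘ (pb1 ∘ @pb2 _ _ _ _ (sp_r A) (sp_l (span_comp B C))).
Proof. now rewrite pb_comm comp_assoc. Qed.

Lemma span_assoc_inv_comm2 :
  sp_r (span_comp A B) ∘ pb_lift span_assoc_inv_comm1 = sp_l C ∘ (pb2 ∘ pb2).
Proof. cbn. now rewrite -comp_assoc pb2_lift !comp_assoc pb_comm. Qed.

Definition span_assoc_inv :
  SpanCell (span_comp A (span_comp B C)) (span_comp (span_comp A B) C).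
Proof.
  refine (@Build_SpanCell _ _ _ _ (span_comp A (span_comp B C))
    (span_comp (span_comp A B) C) (fun i => i) (fun l => l)
    (pb_lift span_assoc_inv_comm2) _ _);
  rewrite disc_map_id comp_idl; cbn.
  - now rewrite -!comp_assoc pb1_lift pb1_lift.
  - now rewrite -!comp_assoc pb2_lift.
Defined.

End Associator.

Section Unitors.
Context (I J : small) (A : Span I J).

Definition span_lun : SpanCell (span_comp (span_id I) A) A.
Proof.
  refine (@Build_SpanCell _ _ _ _ (span_comp (span_id I) A) A (fun i => i) (fun j => j)
    pb2 _ _); rewrite disc_map_id comp_idl; cbn.
  - now rewrite -pb_comm.
  - reflexivity.
Defined.

Lemma span_lun_inv_comm : sp_r (span_id I) ∘ sp_l A = sp_l A ∘ idm (sp_ob A).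
Proof. cbn. now rewrite comp_idl comp_idr. Qed.

Definition span_lun_inv : SpanCell A (span_comp (span_id I) A).
Proof.
  refine (@Build_SpanCell _ _ _ _ A (span_comp (span_id I) A) (fun i => i) (fun j => j)
    (pb_lift span_lun_inv_comm) _ _); rewrite disc_map_id comp_idl; cbn.
  - now rewrite -comp_assoc pb1_lift comp_idl.
  - now rewrite -comp_assoc pb2_lift comp_idr.
Defined.

Definition span_run : SpanCell (span_comp A (span_id J)) A.
Proof.
  refine (@Build_SpanCell _ _ _ _ (span_comp A (span_id J)) A (fun i => i) (fun j => j)
    pb1 _ _); rewrite disc_map_id comp_idl; cbn.
  - reflexivity.
  - now rewrite pb_comm.
Defined.

Lemma span_run_inv_comm : sp_r A ∘ idm (sp_ob A) = sp_l (span_id J) ∘ sp_r A.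
Proof. cbn. now rewrite comp_idl comp_idr. Qed.

Definition span_run_inv : SpanCell A (span_comp A (span_id J)).
Proof.
  refine (@Build_SpanCell _ _ _ _ A (span_comp A (span_id J)) (fun i => i) (fun j => j)
    (pb_lift span_run_inv_comm) _ _); rewrite disc_map_id comp_idl; cbn.
  - now rewrite -comp_assoc pb1_lift comp_idr.
  - now rewrite -comp_assoc pb2_lift comp_idl.
Defined.

End Unitors.

Definition span_data : DoubleData :=
  {| vert := SetCat;
     Hor := Span : SetCat -> SetCat -> Type;
     Cell := SpanCell;
     cell_l := sc_l;
     cell_r := sc_r;
     cell_id := span_cell_id;
     cell_comp := span_cell_comp;
     hid := span_id;
     hid_cell := span_id_cell;
     hcomp := span_comp;
     hcell := span_cell_hcomp;
     hassoc := span_assoc;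
     hlun := span_lun;
     hrun := span_run |}.

Lemma span_cell_laws : CellCategoryLaws span_data.
Proof.
  split; try reflexivity.
  - intros; apply span_cell_eq; try reflexivity; apply comp_assoc.
  - intros; apply span_cell_eq; try reflexivity; apply comp_idl.
  - intros; apply span_cell_eq; try reflexivity; apply comp_idr.
  - split; reflexivity.
Qed.

Lemma span_horizontal_laws : HorizontalFunctorLaws span_data.
Proof.
  split; try reflexivity; intros; apply span_cell_eq; try reflexivity.
  - apply disc_map_id.
  - apply (disc_map_comp v u).
  - apply pb_ext; cat.
  - apply pb_ext; cat.
Qed.

Lemma span_coherence_laws : CoherenceLaws span_data.
Proof.
  split; try (split; reflexivity).
  - intros I J K L A B C; exists (span_assoc_inv A B C).
    split; (apply span_cell_eq; [reflexivity|reflexivity|]); repeat apply pb_ext; cat.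
  - intros I J A; exists (span_lun_inv A).
    split; (apply span_cell_eq; [reflexivity|reflexivity|]); [apply pb_ext|]; cat.
    now rewrite -pb_comm; cat.
  - intros I J A; exists (span_run_inv A).
    split; (apply span_cell_eq; [reflexivity|reflexivity|]); [apply pb_ext|]; cat.
    now rewrite pb_comm; cat.
  - intros; apply span_cell_eq; try reflexivity. repeat apply pb_ext; cat.
  - intros; apply span_cell_eq; try reflexivity. cat.
  - intros; apply span_cell_eq; try reflexivity. cat.
  - intros; apply span_cell_eq; try reflexivity. repeat apply pb_ext; cat.
  - intros; apply span_cell_eq; try reflexivity. repeat apply pb_ext; cat.
Qed.

Definition span_double : PseudoDouble :=
  {| pd_cells := span_cell_laws; pd_horizontal := span_horizontal_laws;
     pd_coherence := span_coherence_laws |}.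

End Spans.

Section IntEn.
Context (V : BaseCategory).

Lemma disc_map_pt (I J : small) (u : I -> J) (i : I) :
  disc_map V u ∘ pt V i = pt V (u i).
Proof. exact (copair_inj (X := fun _ : I => one) (fun i => pt V (u i)) i). Qed.

Lemma disc_map_pt' (I J : small) (u : I -> J) (i : I) (X : V) (x : Hom X one) :
  disc_map V u ∘ (pt V i ∘ x) = pt V (u i) ∘ x.
Proof. now rewrite comp_assoc disc_map_pt. Qed.

Definition int_fam (I J : small) (M : Mat V I J) (p : I * J) : V := M (fst p) (snd p).

Definition int_inj (I J : small) (M : Mat V I J) (i : I) (j : J) :
  Hom (M i j) (coprod (int_fam M)) := inj (int_fam M) (i, j).

Definition int_case (I J : small) (M : Mat V I J) (X : V) (f : forall i j, Hom (M i j) X) :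
  Hom (coprod (int_fam M)) X :=
  copair (X := int_fam M) (fun p => f (fst p) (snd p)).

Lemma int_case_inj (I J : small) (M : Mat V I J) (X : V) (f : forall i j, Hom (M i j) X) i j :
  int_case f ∘ int_inj M i j = f i j.
Proof. exact (copair_inj (X := int_fam M) (fun p => f (fst p) (snd p)) (i, j)). Qed.

Lemma int_case_inj' (I J : small) (M : Mat V I J) (X Y : V)
  (f : forall i j, Hom (M i j) X) i j (x : Hom Y (M i j)) :
  int_case f ∘ (int_inj M i j ∘ x) = f i j ∘ x.
Proof. now rewrite comp_assoc int_case_inj. Qed.

Lemma int_ext (I J : small) (M : Mat V I J) (X : V) (h k : Hom (coprod (int_fam M)) X) :
  (forall i j, h ∘ int_inj M i j = k ∘ int_inj M i j) -> h = k.
Proof. intros e; apply coprod_ext; intros [i j]; apply e. Qed.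

Definition int_hor (I J : small) (M : Mat V I J) : Span V I J :=
  {| sp_ob := coprod (int_fam M);
     sp_l := int_case (fun i j => pt V i ∘ bang (M i j));
     sp_r := int_case (fun i j => pt V j ∘ bang (M i j)) |}.

Ltac int_step :=
  match goal with
  | |- context [comp (int_case ?f) (int_inj ?M ?i ?j)] => rewrite (int_case_inj f i j)
  | |- context [comp (int_case ?f) (comp (int_inj ?M ?i ?j) ?x)] =>
      rewrite (int_case_inj' f (i := i) (j := j) x)
  | |- context [comp (disc_map _ ?u) (pt _ ?i)] => rewrite (disc_map_pt u i)
  | |- context [comp (disc_map _ ?u) (comp (pt _ ?i) ?x)] => rewrite (disc_map_pt' u i x)
  end; cbn.

Ltac int_unfold := idtac.

Ltac int := cbn; int_unfold; cbn;
  repeat ((int_step || cat_step); int_unfold; cbn); try reflexivity;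
  try (f_equal; apply one_uniq).

Definition int_cell_map (I J I' J' : small) (M : Mat V I J) (N : Mat V I' J')
  (a : MatCell M N) : Hom (coprod (int_fam M)) (coprod (int_fam N)) :=
  int_case (fun i j => int_inj N (mc_l a i) (mc_r a j) ∘ mc_map a i j).

Definition int_cell (I J I' J' : small) (M : Mat V I J) (N : Mat V I' J')
  (a : MatCell M N) : SpanCell (int_hor M) (int_hor N).
Proof.
  refine (@Build_SpanCell _ _ _ _ _ (int_hor M) (int_hor N) (mc_l a) (mc_r a)
    (int_cell_map a) _ _); apply int_ext; intros i j; unfold int_cell_map; int.
Defined.

Definition int_map : DoubleMap (mat_double V) (span_double V).
Proof.
  unshelve refine (@Build_DoubleMap (mat_double V) (span_double V) (functor_id SetCat)
    int_hor int_cell _ _ _ _); try reflexivity;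
  intros; (apply span_cell_eq; [reflexivity|reflexivity|]);
  apply int_ext; intros i j; cbn; unfold int_cell_map; int.
Defined.

Section IntComparison.
Context (I J K : small) (M : Mat V I J) (N : Mat V J K).

Definition int_proj1 : Hom (coprod (int_fam (mat_comp M N))) (coprod (int_fam M)) :=
  int_case (M := mat_comp M N) (fun i k =>
    copair (X := mat_term M N i k) (fun j => int_inj M i j ∘ pr2)).

Definition int_proj2 : Hom (coprod (int_fam (mat_comp M N))) (coprod (int_fam N)) :=
  int_case (M := mat_comp M N) (fun i k =>
    copair (X := mat_term M N i k) (fun j => int_inj N j k ∘ pr1)).

Lemma int_comp_comm :
  sp_r (int_hor M) ∘ int_proj1 = sp_l (int_hor N) ∘ int_proj2.
Proof.
  apply int_ext; intros i k; unfold int_proj1, int_proj2; int.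
  apply coprod_ext; intros j; int.
Qed.

Definition int_comp :
  SpanCell (int_hor (mat_comp M N)) (span_comp (int_hor M) (int_hor N)).
Proof.
  refine (@Build_SpanCell _ _ _ _ _ (int_hor (mat_comp M N))
    (span_comp (int_hor M) (int_hor N)) (fun i => i) (fun k => k)
    (pb_lift int_comp_comm) _ _); rewrite disc_map_id comp_idl; cbn;
  rewrite -comp_assoc ?pb1_lift ?pb2_lift;
  apply int_ext; intros i k; unfold int_proj1, int_proj2; int;
  apply coprod_ext; intros j; int.
Defined.

End IntComparison.

Definition int_unit (I : small) : SpanCell (int_hor (mat_id V I)) (span_id V I).
Proof.
  refine (@Build_SpanCell _ _ _ _ _ (int_hor (mat_id V I)) (span_id V I)
    (fun i => i) (fun i => i)
    (int_case (M := mat_id V I) (fun i j => copair (fun _ : i = j => pt V i))) _ _);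
  rewrite disc_map_id; cbn; rewrite !comp_idl; apply int_ext; intros i j; int;
  apply coprod_ext; intros e; int.
  - rewrite -{1}(comp_idr (pt V i)); f_equal; apply one_uniq.
  - destruct e; rewrite -{1}(comp_idr (pt V i)); f_equal; apply one_uniq.
Defined.

Definition int_cells : OplaxCells int_map :=
  @Build_OplaxCells _ _ int_map int_comp int_unit.

Ltac int_unfold ::=
  unfold int_cell_map, int_proj1, int_proj2, mat_cell_hcomp_map, mat_assoc_map,
    mat_lun_map, mat_run_map, mat_cell_comp, mat_cell_id, mat_id_cell, eq_rect_r, tmap.

Ltac eq_refl_subst e :=
  let H := fresh in assert (H : e = eq_refl) by apply proof_irrelevance; subst e.

Lemma int_laws : OplaxLaws int_cells.
Proof.
  split.
  - split; reflexivity.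
  - split; reflexivity.
  - intros I J K I' J' K' M N M' N' [u v f] [v2 w g] e e'. cbn in e; subst v2.
    eq_refl_subst e'.
    apply span_cell_eq; [reflexivity|reflexivity|].
    apply pb_ext; int; apply int_ext; intros i k; int; apply coprod_ext; intros j; int.
  - intros I J u. apply span_cell_eq; [reflexivity|reflexivity|].
    int. apply int_ext; intros i k; int; apply coprod_ext; intros j; int.
  - intros I J K L M N P e1 e2. 
    apply span_cell_eq; [reflexivity|reflexivity|].
    repeat apply pb_ext; int; apply int_ext; intros i l; int; apply coprod_ext; intros k; int;
    apply caser_ext; intros j; int.
  - intros I J M e.
    apply span_cell_eq; [reflexivity|reflexivity|].
    int; apply int_ext; intros i l; int; apply coprod_ext; intros k; int;
    apply caser_ext; intros j; int. destruct j; int.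
  - intros I J M e.
    apply span_cell_eq; [reflexivity|reflexivity|].
    int; apply int_ext; intros i l; int; apply coprod_ext; intros k; int;
    apply casel_ext; intros j; int. destruct j; int.
Qed.

Definition Int : OplaxDoubleFunctor (mat_double V) (span_double V) :=
  {| oplax_laws := int_laws |}.

Definition en_hor (I J : small) (A : Span V I J) : Mat V I J :=
  fun i j => pb (pair (sp_l A) (sp_r A)) (pair (pt V i) (pt V j)).

Section EnEntries.
Context (I J : small) (A : Span V I J) (i : I) (j : J).

Definition en_in : Hom (en_hor A i j) (sp_ob A) := pb1.

Lemma en_in_comm : sp_l A ∘ en_in = pt V i ∘ bang _ /\ sp_r A ∘ en_in = pt V j ∘ bang _.
Proof.
  pose proof (pb_comm (f := pair (sp_l A) (sp_r A)) (g := pair (pt V i) (pt V j))) as e.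
  rewrite !pair_comp in e. unfold en_in; split.
  - apply (f_equal (fun h => pr1 ∘ h)) in e. rewrite !pr1_pair in e.
    rewrite e. f_equal; apply one_uniq.
  - apply (f_equal (fun h => pr2 ∘ h)) in e. rewrite !pr2_pair in e.
    rewrite e. f_equal; apply one_uniq.
Qed.

Lemma en_lift_comm (X : V) (h : Hom X (sp_ob A)) :
  sp_l A ∘ h = pt V i ∘ bang X -> sp_r A ∘ h = pt V j ∘ bang X ->
  pair (sp_l A) (sp_r A) ∘ h = pair (pt V i) (pt V j) ∘ bang X.
Proof. intros e1 e2; now rewrite !pair_comp e1 e2. Qed.

Definition en_lift (X : V) (h : Hom X (sp_ob A)) (el : sp_l A ∘ h = pt V i ∘ bang X)
  (er : sp_r A ∘ h = pt V j ∘ bang X) : Hom X (en_hor A i j) :=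
  pb_lift (en_lift_comm el er).

Lemma en_in_lift (X : V) (h : Hom X (sp_ob A)) el er : en_in ∘ @en_lift X h el er = h.
Proof. apply pb1_lift. Qed.

Lemma en_in_lift' (X Y : V) (h : Hom X (sp_ob A)) el er (x : Hom Y X) :
  en_in ∘ (@en_lift X h el er ∘ x) = h ∘ x.
Proof. now rewrite comp_assoc en_in_lift. Qed.

Lemma en_ext (X : V) (h k : Hom X (en_hor A i j)) : en_in ∘ h = en_in ∘ k -> h = k.
Proof. intros e; apply pb_ext; [exact e | apply one_uniq]. Qed.

End EnEntries.

Lemma comp_bang (X Y Z : V) (p : Hom one Z) (g : Hom X Y) (f : Hom Y one) :
  p ∘ f ∘ g = p ∘ bang X.
Proof. rewrite -comp_assoc; f_equal; apply one_uniq. Qed.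

Lemma en_cell_comm_l (I J I' J' : small) (A : Span V I J) (B : Span V I' J')
  (a : SpanCell A B) i j :
  sp_l B ∘ (sc_map a ∘ en_in A i j) = pt V (sc_l a i) ∘ bang _.
Proof.
  rewrite comp_assoc sc_comm_l -comp_assoc (proj1 (en_in_comm A i j)).
  apply disc_map_pt'.
Qed.

Lemma en_cell_comm_r (I J I' J' : small) (A : Span V I J) (B : Span V I' J')
  (a : SpanCell A B) i j :
  sp_r B ∘ (sc_map a ∘ en_in A i j) = pt V (sc_r a j) ∘ bang _.
Proof.
  rewrite comp_assoc sc_comm_r -comp_assoc (proj2 (en_in_comm A i j)).
  apply disc_map_pt'.
Qed.

Definition en_cell (I J I' J' : small) (A : Span V I J) (B : Span V I' J')
  (a : SpanCell A B) : MatCell (en_hor A) (en_hor B) :=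
  {| mc_l := sc_l a; mc_r := sc_r a;
     mc_map := fun i j => en_lift (en_cell_comm_l a i j) (en_cell_comm_r a i j) |}.

Ltac en_step :=
  match goal with
  | |- context [comp (en_in _ _ _) (@en_lift ?I ?J ?A ?i ?j ?X ?h ?el ?er)] =>
      rewrite (@en_in_lift I J A i j X h el er)
  | |- context [comp (en_in _ _ _) (comp (@en_lift ?I ?J ?A ?i ?j ?X ?h ?el ?er) ?x)] =>
      rewrite (@en_in_lift' I J A i j X _ h el er x)
  end; cbn.

Ltac en_unfold := idtac.

Ltac en := cbn; en_unfold; cbn;
  repeat ((en_step || cat_step); en_unfold; cbn); try reflexivity.

Definition en_map : DoubleMap (span_double V) (mat_double V).
Proof.
  unshelve refine (@Build_DoubleMap (span_double V) (mat_double V) (functor_id SetCat)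
    en_hor en_cell _ _ _ _); try reflexivity;
  intros; apply mat_cell_eq; intros i j; apply en_ext; en.
Defined.

Section EnComparison.
Context (I J K : small) (A : Span V I J) (B : Span V J K) (i : I) (k : K) (j : J).

Lemma en_comp_comm :
  sp_r A ∘ (en_in A i j ∘ pr2) = sp_l B ∘ (en_in B j k ∘ pr1).
Proof.
  now rewrite !comp_assoc (proj1 (en_in_comm B j k)) (proj2 (en_in_comm A i j)) !comp_bang.
Qed.

Lemma en_comp_comm_l :
  sp_l (span_comp A B) ∘ pb_lift en_comp_comm = pt V i ∘ bang _.
Proof.
  cbn. now rewrite -comp_assoc pb1_lift !comp_assoc (proj1 (en_in_comm A i j)) comp_bang.
Qed.

Lemma en_comp_comm_r :
  sp_r (span_comp A B) ∘ pb_lift en_comp_comm = pt V k ∘ bang _.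
Proof.
  cbn. now rewrite -comp_assoc pb2_lift !comp_assoc (proj2 (en_in_comm B j k)) comp_bang.
Qed.

End EnComparison.

Definition en_comp_map (I J K : small) (A : Span V I J) (B : Span V J K) i k :
  Hom (mat_comp (en_hor A) (en_hor B) i k) (en_hor (span_comp A B) i k) :=
  copair (X := mat_term (en_hor A) (en_hor B) i k)
    (fun j => en_lift (en_comp_comm_l A B i k j) (en_comp_comm_r A B i k j)).

Definition en_comp (I J K : small) (A : Span V I J) (B : Span V J K) :
  MatCell (mat_comp (en_hor A) (en_hor B)) (en_hor (span_comp A B)) :=
  {| mc_l := fun i => i; mc_r := fun k => k; mc_map := en_comp_map A B |}.

Lemma en_unit_comm (I : small) (i j : I) (e : i = j) :
  idm (disc V I) ∘ pt V i = pt V j ∘ bang one.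
Proof. destruct e. rewrite comp_idl -{1}(comp_idr (pt V i)). f_equal; apply one_uniq. Qed.

Definition en_unit_map (I : small) (i j : I) :
  Hom (mat_id V I i j) (en_hor (span_id V I) i j) :=
  copair (fun e : i = j =>
    @en_lift I I (span_id V I) i j one (pt V i) (en_unit_comm eq_refl) (en_unit_comm e)).

Definition en_unit (I : small) : MatCell (mat_id V I) (en_hor (span_id V I)) :=
  {| mc_l := fun i => i; mc_r := fun i => i; mc_map := @en_unit_map I |}.

Definition en_cells : LaxCells en_map :=
  @Build_LaxCells _ _ en_map en_comp en_unit.

Ltac en_unfold ::=
  unfold en_comp_map, en_unit_map, mat_cell_hcomp_map, mat_assoc_map,
    mat_lun_map, mat_run_map, mat_cell_comp, mat_cell_id, mat_id_cell, eq_rect_r, tmap.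

Lemma en_laws : LaxLaws en_cells.
Proof.
  split.
  - split; reflexivity.
  - split; reflexivity.
  - intros I J K I' J' K' A B A' B' [u v f ? ?] [v2 w g ? ?] e e'. cbn in e; subst v2.
    eq_refl_subst e'.
    apply mat_cell_eq; intros i k; apply coprod_ext; intros j; en.
    apply en_ext; en. apply pb_ext; en.
  - intros I J u.
    apply mat_cell_eq; intros i k; apply coprod_ext; intros e; en.
    apply en_ext; en. apply disc_map_pt.
  - intros I J K L A B C e1 e2. eq_refl_subst e1; eq_refl_subst e2.
    apply mat_cell_eq; intros i l; apply coprod_ext; intros k; en.
    apply (caser_ext (X := mat_term (en_hor A) (en_hor B) i k)); intros j; en.
    apply en_ext; en. repeat apply pb_ext; en.
  - intros I J A e. eq_refl_subst e.
    apply mat_cell_eq; intros i k; apply coprod_ext; intros j; en.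
    apply (caser_ext (X := fun _ : i = j => one)); intros e; en.
    apply en_ext; en. destruct e; en.
  - intros I J A e. eq_refl_subst e.
    apply mat_cell_eq; intros i k; apply coprod_ext; intros j; en.
    apply (casel_ext (X := fun _ : j = k => one)); intros e; en.
    apply en_ext; en. destruct e; en.
Qed.

Definition En : LaxDoubleFunctor (span_double V) (mat_double V) :=
  {| lax_laws := en_laws |}.

End IntEn.

Section Enriched.
Context (V : BaseCategory).

Definition tassoc {A B C : V} : Hom (times (times A B) C) (times A (times B C)) :=
  pair (pr1 ∘ pr1) (pair (pr2 ∘ pr1) pr2).

Record EnrichedCat := {
  ec_ob : small;
  ec_hom : ec_ob -> ec_ob -> V;
  ec_comp : forall a b c, Hom (times (ec_hom b c) (ec_hom a b)) (ec_hom a c);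
  ec_id : forall a, Hom one (ec_hom a a);
  ec_assoc : forall a b c d,
    ec_comp a b d ∘ tmap (ec_comp b c d) (idm (ec_hom a b)) =
    ec_comp a c d ∘ tmap (idm (ec_hom c d)) (ec_comp a b c) ∘ tassoc;
  ec_idl : forall a b, ec_comp a b b ∘ tmap (ec_id b) (idm (ec_hom a b)) = pr2;
  ec_idr : forall a b, ec_comp a a b ∘ tmap (idm (ec_hom a b)) (ec_id a) = pr1 }.

Arguments ec_hom {e} _ _.
Arguments ec_comp {e} a b c.
Arguments ec_id {e} a.

Record EnrichedFunctor (C D : EnrichedCat) := {
  ef_ob : ec_ob C -> ec_ob D;
  ef_map : forall a b, Hom (ec_hom a b) (ec_hom (ef_ob a) (ef_ob b));
  ef_comp : forall a b c,
    ef_map a c ∘ ec_comp a b c =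
    ec_comp (ef_ob a) (ef_ob b) (ef_ob c) ∘ tmap (ef_map b c) (ef_map a b);
  ef_id : forall a, ef_map a a ∘ ec_id a = ec_id (ef_ob a) }.

Lemma enriched_functor_eq (C D : EnrichedCat) (u : ec_ob C -> ec_ob D)
  (f g : forall a b, Hom (ec_hom a b) (ec_hom (u a) (u b))) fc fi gc gi :
  (forall a b, f a b = g a b) ->
  @Build_EnrichedFunctor C D u f fc fi = @Build_EnrichedFunctor C D u g gc gi.
Proof.
  intros e.
  assert (h : f = g).
  { apply functional_extensionality_dep; intros a.
    apply functional_extensionality_dep; intros b; apply e. }
  subst g; f_equal; apply proof_irrelevance.
Qed.

Definition enriched_functor_id (C : EnrichedCat) : EnrichedFunctor C C.
Proof.
  refine {| ef_ob := fun a => a; ef_map := fun a b => idm (ec_hom a b) |}.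
  - intros a b c; cat.
  - intros a; cat.
Defined.

Definition enriched_functor_comp (C D E : EnrichedCat) (G : EnrichedFunctor D E)
  (F : EnrichedFunctor C D) : EnrichedFunctor C E.
Proof.
  refine {| ef_ob := fun a => ef_ob G (ef_ob F a);
            ef_map := fun a b => ef_map G (ef_ob F a) (ef_ob F b) ∘ ef_map F a b |}.
  - intros a b c; rewrite -comp_assoc ef_comp comp_assoc ef_comp. cat.
  - intros a; now rewrite -comp_assoc !ef_id.
Defined.

Definition VCat : Category.
Proof.
  refine {| Ob := EnrichedCat; Hom := EnrichedFunctor; idm := enriched_functor_id;
            comp := enriched_functor_comp |}; intros.
  - apply enriched_functor_eq; intros a b; apply comp_assoc.
  - destruct f; apply enriched_functor_eq; intros a b; apply comp_idl.
  - destruct f; apply enriched_functor_eq; intros a b; apply comp_idr.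
Defined.

End Enriched.

Section Internal.
Context (V : BaseCategory).

(* [ic_comp] composes pairs (f, g) with target f = source g.  In the last three laws
   the proofs [e] that the given pairs are composable always exist. *)
Record InternalCat (O : V) := {
  ic_arr : V;
  ic_src : Hom ic_arr O;
  ic_tgt : Hom ic_arr O;
  ic_id : Hom O ic_arr;
  ic_comp : Hom (pb ic_tgt ic_src) ic_arr;
  ic_src_id : ic_src ∘ ic_id = idm O;
  ic_tgt_id : ic_tgt ∘ ic_id = idm O;
  ic_src_comp : ic_src ∘ ic_comp = ic_src ∘ pb1;
  ic_tgt_comp : ic_tgt ∘ ic_comp = ic_tgt ∘ pb2;
  ic_idl : forall e : ic_tgt ∘ (ic_id ∘ ic_src) = ic_src ∘ idm ic_arr,
    ic_comp ∘ pb_lift e = idm ic_arr;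
  ic_idr : forall e : ic_tgt ∘ idm ic_arr = ic_src ∘ (ic_id ∘ ic_tgt),
    ic_comp ∘ pb_lift e = idm ic_arr;
  ic_assoc : forall
    (e1 : ic_tgt ∘ (ic_comp ∘ pb1) = ic_src ∘ @pb2 _ _ _ _ (ic_tgt ∘ pb2) ic_src)
    (e2 : ic_tgt ∘ (pb2 ∘ pb1) = ic_src ∘ @pb2 _ _ _ _ (ic_tgt ∘ pb2) ic_src)
    (e3 : ic_tgt ∘ (pb1 ∘ pb1) = ic_src ∘ (ic_comp ∘ pb_lift e2)),
    ic_comp ∘ pb_lift e1 = ic_comp ∘ pb_lift e3 }.

Record InternalFunctor (O P : V) (C : InternalCat O) (D : InternalCat P) (u : Hom O P) := {
  if_map : Hom (ic_arr C) (ic_arr D);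
  if_src : ic_src D ∘ if_map = u ∘ ic_src C;
  if_tgt : ic_tgt D ∘ if_map = u ∘ ic_tgt C;
  if_id : if_map ∘ ic_id C = ic_id D ∘ u;
  if_comp : forall e : ic_tgt D ∘ (if_map ∘ pb1) = ic_src D ∘ (if_map ∘ pb2),
    if_map ∘ ic_comp C = ic_comp D ∘ pb_lift e }.

Lemma internal_functor_eq (O P : V) (C : InternalCat O) (D : InternalCat P) (u : Hom O P)
  (F G : InternalFunctor C D u) : if_map F = if_map G -> F = G.
Proof.
  destruct F as [f f1 f2 f3 f4], G as [g g1 g2 g3 g4]; cbn; intros e; subst g.
  f_equal; apply proof_irrelevance.
Qed.

Lemma internal_functor_composable (O P : V) (C : InternalCat O) (D : InternalCat P)
  (u : Hom O P) (F : InternalFunctor C D u) :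
  ic_tgt D ∘ (if_map F ∘ pb1) = ic_src D ∘ (if_map F ∘ @pb2 _ _ _ _ (ic_tgt C) (ic_src C)).
Proof. now rewrite !comp_assoc if_src if_tgt -!comp_assoc pb_comm. Qed.

Record DiscCat := {
  dc_ob : small;
  dc_cat : InternalCat (disc V dc_ob) }.

Record DiscFunctor (C D : DiscCat) := {
  df_ob : dc_ob C -> dc_ob D;
  df_functor : InternalFunctor (dc_cat C) (dc_cat D) (disc_map V df_ob) }.

Lemma disc_functor_eq (C D : DiscCat) (F G : DiscFunctor C D) :
  df_ob F = df_ob G -> if_map (df_functor F) = if_map (df_functor G) -> F = G.
Proof.
  destruct F as [u F], G as [v G]; cbn; intros e1 e2; subst v.
  f_equal; now apply internal_functor_eq.
Qed.

Definition disc_functor_id (C : DiscCat) : DiscFunctor C C.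
Proof.
  refine {| df_ob := fun i => i |}.
  refine {| if_map := idm (ic_arr (dc_cat C)) |}; rewrite ?disc_map_id.
  - now rewrite comp_idl comp_idr.
  - now rewrite comp_idl comp_idr.
  - now rewrite comp_idl comp_idr.
  - intros e; rewrite comp_idl -{1}(comp_idr (ic_comp (dc_cat C))); f_equal.
    apply pb_ext; cat.
Defined.

Definition disc_functor_comp (C D E : DiscCat) (G : DiscFunctor D E) (F : DiscFunctor C D) :
  DiscFunctor C E.
Proof.
  refine {| df_ob := fun i => df_ob G (df_ob F i) |}.
  refine {| if_map := if_map (df_functor G) ∘ if_map (df_functor F) |};
    rewrite ?(disc_map_comp V (df_ob G) (df_ob F)).
  - now rewrite comp_assoc if_src -!comp_assoc if_src.
  - now rewrite comp_assoc if_tgt -!comp_assoc if_tgt.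
  - now rewrite -comp_assoc if_id !comp_assoc if_id.
  - intros e.
    rewrite -comp_assoc (if_comp (internal_functor_composable (df_functor F))).
    rewrite comp_assoc (if_comp (internal_functor_composable (df_functor G))) -comp_assoc.
    f_equal; apply pb_ext; cat.
Defined.

Definition CatD : Category.
Proof.
  refine {| Ob := DiscCat; Hom := DiscFunctor; idm := disc_functor_id;
            comp := disc_functor_comp |}; intros; apply disc_functor_eq; try reflexivity.
  - apply comp_assoc.
  - apply comp_idl.
  - apply comp_idr.
Defined.

End Internal.

(* Main.v *)
Require Import Defs.
From Stdlib Require Import ssreflect FunctionalExtensionality ProofIrrelevance.
From Stdlib Require Import IndefiniteDescription.

(* Each of the four conditions says that an object over [I • 1] is the coproduct of its
   fibres and that the fibre over [i] of a coproduct indexed by [I] is its [i]-th summand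
   ([fibre_decomposition]).  For (3) and (4) the point is that Int and En are adjoint on
   the categories of horizontal 1-cells and 2-cells, over all boundaries, and that an
   adjunction one of whose functors is an equivalence has invertible unit and counit.

   En is lax, so it always sends discretely internal categories to enriched ones
   ([externalize]).  Under fibre decomposition, morphisms out of the object of arrows, and
   out of the object of composable pairs, are determined and constructed on the fibres over
   pairs, resp. triples, of objects, which makes this functor full, faithful and
   essentially surjective. *)

Set Implicit Arguments.
Unset Strict Implicit.
Unset Printing Implicit Defensive.

Local Open Scope cat_scope.

(** * Equivalences of categories and adjunctions *)

Section Isomorphisms.
Context (C : Category).

Lemma iso_comp (A B D : C) (g : Hom B D) (f : Hom A B) :
  is_iso g -> is_iso f -> is_iso (g ∘ f).
Proof.
  intros [g' [g1 g2]] [f' [f1 f2]]; exists (f' ∘ g'); split.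
  - now rewrite comp_assoc -(comp_assoc f') g1 comp_idr f1.
  - now rewrite comp_assoc -(comp_assoc g) f2 comp_idr g2.
Qed.

Lemma iso_cancel_r (A B D : C) (g : Hom B D) (f : Hom A B) :
  is_iso f -> is_iso (g ∘ f) -> is_iso g.
Proof.
  intros hf hgf; destruct hf as [f' [f1 f2]].
  rewrite -(comp_idr g) -f2 comp_assoc; apply iso_comp; [exact hgf|].
  now exists f.
Qed.

Lemma iso_cancel_l (A B D : C) (g : Hom B D) (f : Hom A B) :
  is_iso g -> is_iso (g ∘ f) -> is_iso f.
Proof.
  intros hg hgf; destruct hg as [g' [g1 g2]].
  rewrite -(comp_idl f) -g1 -comp_assoc; apply iso_comp; [|exact hgf].
  now exists g.
Qed.

Lemma iso_idm (A : C) : is_iso (idm A).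
Proof. exists (idm A); now rewrite comp_idl. Qed.

Lemma iso_epi (A B D : C) (f : Hom A B) (h k : Hom B D) :
  is_iso f -> h ∘ f = k ∘ f -> h = k.
Proof.
  intros [g [_ e]] H.
  now rewrite -(comp_idr h) -(comp_idr k) -e !comp_assoc H.
Qed.

Lemma iso_mono (A B D : C) (f : Hom B D) (h k : Hom A B) :
  is_iso f -> f ∘ h = f ∘ k -> h = k.
Proof.
  intros [g [e _]] H.
  now rewrite -(comp_idl h) -(comp_idl k) -e -!comp_assoc H.
Qed.

End Isomorphisms.

Lemma fmap_iso (C D : Category) (F : Functor C D) (A B : C) (f : Hom A B) :
  is_iso f -> is_iso (fmap F f).
Proof.
  intros [g [e1 e2]]; exists (fmap F g).
  now rewrite -!fmap_comp e1 e2 !fmap_id.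
Qed.

Section Equivalences.
Context (C D : Category).

Definition full (F : Functor C D) : Prop :=
  forall (A B : C) (g : Hom (F A) (F B)), exists f : Hom A B, fmap F f = g.

Definition faithful (F : Functor C D) : Prop :=
  forall (A B : C) (f g : Hom A B), fmap F f = fmap F g -> f = g.

Definition essentially_surjective (F : Functor C D) : Prop :=
  forall B : D, exists (A : C) (e : Hom (F A) B), is_iso e.

Record weak_equivalence (F : Functor C D) : Prop := {
  weq_full : full F;
  weq_faithful : faithful F;
  weq_ess_surj : essentially_surjective F }.

(** Naturality along the invertible unit and counit makes both [F] and [G] faithful. Fullness of [F]
    then follows from faithfulness of [G]: conjugating [fmap G g] with the unit gives an arrow whose
    image under [G] after [F] is [fmap G g]. *)
Lemma equivalence_weak (F : Functor C D) : is_equivalence F -> weak_equivalence F.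
Proof.
  intros (G & eta & eps & heta & heps).
  assert (fG : forall (A B : D) (f g : Hom A B), fmap G f = fmap G g -> f = g).
  { intros A B f g e; apply (iso_epi (heps A)).
    pose proof (nt_nat eps f) as ef; pose proof (nt_nat eps g) as eg; cbn in ef, eg.
    now rewrite -ef -eg e. }
  assert (fF : faithful F).
  { intros A B f g e; apply (iso_mono (heta B)).
    pose proof (nt_nat eta f) as ef; pose proof (nt_nat eta g) as eg; cbn in ef, eg.
    now rewrite ef eg e. }
  split; [|exact fF|].
  - intros A B g; destruct (heta B) as [r [r1 r2]].
    exists (r ∘ (fmap G g ∘ eta A)); apply fG, (iso_epi (heta A)).
    pose proof (nt_nat eta (r ∘ (fmap G g ∘ eta A))) as e; cbn in e.
    now rewrite -e comp_assoc r2 comp_idl.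
  - intros B; exists (G B), (eps B); apply heps.
Qed.

(** Indefinite description chooses preimages of arrows and, for each [B], an object [gob B] with an
    isomorphism [e B] and its inverse [r B]. The inverse functor sends [g] to the preimage of
    [r B ∘ (g ∘ e A)]; its laws can be checked after applying the faithful [F]. *)
Lemma weak_equivalence_inverse (F : Functor C D) :
  weak_equivalence F -> equivalent_categories D C.
Proof.
  intros [fu fa es].
  assert (fu' : forall A B (g : Hom (F A) (F B)), {f : Hom A B | fmap F f = g})
    by (intros; apply constructive_indefinite_description, fu).
  assert (es' : forall B : D, {A : C & {e : Hom (F A) B &
    {r : Hom B (F A) | r ∘ e = idm (F A) /\ e ∘ r = idm B}}}).
  { intros B; destruct (constructive_indefinite_description _ (es B)) as [A hA].
    destruct (constructive_indefinite_description _ hA) as [e he].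
    exists A, e; apply (constructive_indefinite_description _ he). }
  clear fu es.
  pose (gob := fun B => projT1 (es' B)).
  pose (e := fun B => projT1 (projT2 (es' B)) : Hom (F (gob B)) B).
  pose (r := fun B => proj1_sig (projT2 (projT2 (es' B))) : Hom B (F (gob B))).
  assert (re : forall B, r B ∘ e B = idm (F (gob B)))
    by (intros B; exact (proj1 (proj2_sig (projT2 (projT2 (es' B)))))).
  assert (er : forall B, e B ∘ r B = idm B)
    by (intros B; exact (proj2 (proj2_sig (projT2 (projT2 (es' B)))))).
  pose (gmap := fun A B (g : Hom A B) => proj1_sig (fu' _ _ (r B ∘ (g ∘ e A)))).
  assert (gmapE : forall A B (g : Hom A B), fmap F (gmap A B g) = r B ∘ (g ∘ e A))
    by (intros A B g; exact (proj2_sig (fu' _ _ (r B ∘ (g ∘ e A))))).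
  clearbody gob e r gmap.
  assert (g_id : forall A, gmap A A (idm A) = idm (gob A)).
  { intros A; apply fa; now rewrite gmapE fmap_id comp_idl re. }
  assert (g_comp : forall A B E (g : Hom B E) (f : Hom A B),
    gmap A E (g ∘ f) = gmap B E g ∘ gmap A B f).
  { intros A B E g f; apply fa; rewrite fmap_comp !gmapE.
    rewrite !comp_assoc -(comp_assoc (r E ∘ g) (e B)) er comp_idr.
    reflexivity. }
  pose (G := {| fobj := gob; fmap := gmap; fmap_id := g_id; fmap_comp := g_comp |}).
  exists G, F.
  unshelve eexists (@Build_NatTrans _ _ (functor_id D) (functor_comp F G) r _).
  { intros A B f; cbn; rewrite gmapE -!comp_assoc er. now rewrite comp_idr. }
  (* The second transformation is a preimage of [e] at image objects; its inverse is a preimage of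
     [r] there. *)
  pose (s := fun A => proj1_sig (fu' _ _ (e (F A)))).
  assert (sE : forall A, fmap F (s A) = e (F A))
    by (intros A; exact (proj2_sig (fu' _ _ (e (F A))))).
  unshelve eexists (@Build_NatTrans _ _ (functor_comp G F) (functor_id C) s _).
  { intros A B f; apply fa; cbn.
    now rewrite !fmap_comp gmapE !sE comp_assoc er comp_idl. }
  split.
  - intros B; exists (e B); split; [apply er | apply re].
  - intros A; cbn. destruct (fu' _ _ (r (F A))) as [t tE].
    exists t; split; apply fa; cbn; rewrite fmap_comp fmap_id tE sE; [apply re | apply er].
Qed.

End Equivalences.

Section AdjointEquivalences.
Context (C D : Category) (F : Functor C D) (G : Functor D C) (a : Adjunction F G).

(** A preimage [s] of the counit at [F A] is inverse to the unit at [A], by the triangle identities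
    and faithfulness. The counit is then invertible at objects [F A], and everywhere by essential
    surjectivity and naturality. *)
Lemma left_adjoint_equivalence : weak_equivalence F -> is_adjoint_equivalence a.
Proof.
  intros [fu fa es].
  assert (hu : nat_iso (adj_unit a)).
  { intros A; destruct (fu _ _ (adj_counit a (F A))) as [s sE].
    exists s; split.
    - apply fa; rewrite fmap_comp fmap_id sE; exact (adj_triangle_l a A).
    - pose proof (nt_nat (adj_unit a) s) as e; cbn in e.
      rewrite e sE; exact (adj_triangle_r a (F A)). }
  split; [exact hu|]; intros B.
  destruct (es B) as (A & e & he).
  pose proof (nt_nat (adj_counit a) e) as n; cbn in n.
  apply (iso_cancel_r (f := fmap F (fmap G e))); [now apply fmap_iso, fmap_iso|].
  rewrite n; apply iso_comp; [exact he|].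
  apply (iso_cancel_r (f := fmap F (adj_unit a A))); [apply fmap_iso, hu|].
  rewrite (adj_triangle_l a A); apply iso_idm.
Qed.

(** Mirror argument: a preimage of the unit at [G B] inverts the counit at [B], and invertibility of
    the unit is transported from objects [G B]. *)
Lemma right_adjoint_equivalence : weak_equivalence G -> is_adjoint_equivalence a.
Proof.
  intros [fu fa es].
  assert (hc : nat_iso (adj_counit a)).
  { intros B; destruct (fu _ _ (adj_unit a (G B))) as [s sE].
    exists s; split.
    - pose proof (nt_nat (adj_counit a) s) as e; cbn in e.
      rewrite -e sE; exact (adj_triangle_l a (G B)).
    - apply fa; rewrite fmap_comp fmap_id sE; exact (adj_triangle_r a B). }
  split; [|exact hc]; intros A.
  destruct (es A) as (B & e & he).
  pose proof (nt_nat (adj_unit a) e) as n; cbn in n.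
  apply (iso_cancel_r (f := e)); [exact he|].
  rewrite n; apply iso_comp; [now apply fmap_iso, fmap_iso|].
  apply (iso_cancel_l (g := fmap G (adj_counit a B))); [apply fmap_iso, hc|].
  rewrite (adj_triangle_r a B); apply iso_idm.
Qed.

End AdjointEquivalences.

(** * Fibre decomposition from the four conditions *)

(** A generalized element of the fibre of [f] over [i], described without choosing a pullback. *)
Definition lies_over (V : BaseCategory) (I : small) (A : V) (f : Hom A (disc V I)) (i : I)
  (Y : V) (x : Hom Y A) : Prop := f ∘ x = pt V i ∘ bang Y.

Definition summand_index (V : BaseCategory) (I : small) (X : I -> V) :
  Hom (coprod X) (disc V I) := copair (fun i => pt V i ∘ bang (X i)).

(** Stated on generalized elements, so that several index maps can be treated one after the other.
    The clauses are uniqueness and existence of maps defined fibre by fibre, then existence and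
    uniqueness of factorizations through a summand. *)
Record fibre_decomposition (V : BaseCategory) : Prop := {
  fibre_ext : forall (I : small) (A : V) (f : Hom A (disc V I)) (X : V) (h k : Hom A X),
    (forall i Y (x : Hom Y A), lies_over f i x -> h ∘ x = k ∘ x) -> h = k;
  fibre_case : forall (I : small) (A : V) (f : Hom A (disc V I)) (X : V)
    (g : forall i, Hom (pb f (pt V i)) X),
    exists h : Hom A X, forall i Y (x : Hom Y A) (e : lies_over f i x),
      h ∘ x = g i ∘ pb_lift e;
  summand_lift : forall (I : small) (X : I -> V) i Y (x : Hom Y (coprod X)),
    lies_over (summand_index X) i x -> exists y, x = inj X i ∘ y;
  summand_mono : forall (I : small) (X : I -> V) i Y (y z : Hom Y (X i)),
    inj X i ∘ y = inj X i ∘ z -> y = z }.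

Section Conditions.
Context (V : BaseCategory).

Lemma summand_index_inj (I : small) (X : I -> V) i :
  summand_index X ∘ inj X i = pt V i ∘ bang (X i).
Proof. exact (copair_inj (X := X) (fun i => pt V i ∘ bang (X i)) i). Qed.

Lemma lies_over_pb1 (I : small) (A : V) (f : Hom A (disc V I)) (i : I) :
  lies_over f i (@pb1 _ _ _ _ f (pt V i)).
Proof. unfold lies_over; rewrite pb_comm; f_equal; apply one_uniq. Qed.

(** The inverse of the counit gives the first two clauses, the inverse of the unit the last two. *)
Lemma adjoint_fibre_decomposition :
  (forall I : small, is_adjoint_equivalence (family_adjunction V I)) -> fibre_decomposition V.
Proof.
  intros H.
  assert (hc : forall (I : small) (A : V) (f : Hom A (disc V I)),
    is_iso (copair (fun i => @pb1 _ _ _ _ f (pt V i)))).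
  { intros I A f; destruct (proj2 (H I) {| so_dom := A; so_map := f |}) as [g [e1 e2]].
    exists (sh_map g); split.
    - exact (f_equal (@sh_map _ _ _ _) e1).
    - exact (f_equal (@sh_map _ _ _ _) e2). }
  assert (hu : forall (I : small) (X : I -> V) i, is_iso (pb_lift (family_unit_comm X i))).
  { intros I X i; destruct (proj1 (H I) X) as [g [e1 e2]].
    exists (g i); split.
    - exact (f_equal (fun k => k i) e1).
    - exact (f_equal (fun k => k i) e2). }
  split.
  - intros I A f X h k e; apply (iso_epi (hc I A f)), coprod_ext; intros i.
    cat; apply (e i), lies_over_pb1.
  - intros I A f X g; destruct (hc I A f) as [r [r1 r2]].
    exists (copair g ∘ r); intros i Y x e.
    (* The counit restricts to [pb1] on the [i]-th summand, so its inverse [r] sends an element over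
       [i] into that summand. *)
    assert (E : r ∘ x = inj (fun i => pb f (pt V i)) i ∘ pb_lift e).
    { rewrite -(comp_idl (inj (fun i => pb f (pt V i)) i ∘ pb_lift e)) -r1.
      rewrite -comp_assoc; f_equal. cat. }
    rewrite -comp_assoc E; cat.
  - intros I X i Y x e; destruct (hu I X i) as [r [r1 r2]].
    exists (r ∘ pb_lift e).
    assert (E : inj X i ∘ r = pb1).
    { rewrite -(comp_idr pb1) -r2; cat. }
    rewrite comp_assoc E pb1_lift; reflexivity.
  - intros I X i Y y z e; apply (iso_mono (hu I X i)), pb_ext; cat; [exact e|].
    apply one_uniq.
Qed.

(** An object of [V] is the same as an object over [one]. Under this identification [family_total]
    becomes [coprod_slice] of the constant family [one], and the three properties transfer. *)
Lemma family_total_weak_equivalence (I : small) :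
  is_equivalence (coprod_slice (fun _ : I => one (V := V))) ->
  weak_equivalence (family_total V I).
Proof.
  intros H; destruct (equivalence_weak H) as [fu fa es].
  pose (over_one := fun (X : I -> V) (i : I) =>
    {| so_dom := X i; so_map := bang (X i) |} : slice one).
  assert (hom : forall (X Y : I -> V) (f : forall i, Hom (X i) (Y i)) i,
    bang (Y i) ∘ f i = bang (X i)) by (intros; apply one_uniq).
  pose (hom_over_one := fun (X Y : I -> V) (f : forall i, Hom (X i) (Y i)) =>
    (fun i => @Build_SliceHom _ _ (over_one X i) (over_one Y i) (f i) (hom X Y f i))
    : @Hom (prod_cat (fun _ => slice one)) (over_one X) (over_one Y)).
  split.
  - intros X Y g; destruct (fu (over_one X) (over_one Y) g) as [f e].
    exists (fun i => sh_map (f i)).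
    apply slice_hom_eq; exact (f_equal (@sh_map _ _ _ _) e).
  - intros X Y f g e.
    assert (E : hom_over_one X Y f = hom_over_one X Y g).
    { apply fa, slice_hom_eq; exact (f_equal (@sh_map _ _ _ _) e). }
    exact (f_equal (fun k i => sh_map (k i)) E).
  - intros B; destruct (es B) as (A & e & he).
    (* Uniqueness of maps to [one] makes this an equality rather than an isomorphism, so [e] is
       transported by rewriting. *)
    assert (E : A = over_one (fun i => so_dom (A i))).
    { apply functional_extensionality_dep; intros i; unfold over_one.
      destruct (A i) as [X m]; cbn; f_equal; apply one_uniq. }
    exists (fun i => so_dom (A i)). rewrite E in e he.
    exists e; exact he.
Qed.

Lemma extensive_adjoint (H : extensive V) (I : small) :
  is_adjoint_equivalence (family_adjunction V I).
Proof.
  apply left_adjoint_equivalence, family_total_weak_equivalence, H.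
Qed.

End Conditions.

(** * Categories of horizontal 1-cells and 2-cells *)

Record HorArrow (D : DoubleData) := {
  ha_src : D;
  ha_tgt : D;
  ha_hor : Hor ha_src ha_tgt }.

(** Bundling the boundary into the objects admits 2-cells with arbitrary vertical boundaries as
    arrows. Horizontal composition is forgotten, so lax and oplax double functors alike act as
    ordinary functors. *)
Definition cell_category (D : PseudoDouble) : Category :=
  {| Ob := HorArrow D;
     Hom := fun M N => Cell (ha_hor M) (ha_hor N);
     idm := fun M => cell_id (ha_hor M);
     comp := fun M N P b a => b ∙ a;
     comp_assoc := fun M N P Q c b a => cell_assoc (pd_cells D) c b a;
     comp_idl := fun M N a => cell_idl (pd_cells D) a;
     comp_idr := fun M N a => cell_idr (pd_cells D) a |}.

Definition cell_functor (D E : PseudoDouble) (F : DoubleMap D E) :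
  Functor (cell_category D) (cell_category E) :=
  @Build_Functor (cell_category D) (cell_category E)
    (fun M => {| ha_hor := dm_hor F (ha_hor M) |})
    (fun M N a => dm_cell F a)
    (fun M => dm_cell_id F (ha_hor M))
    (fun M N P b a => dm_cell_comp F b a).

Lemma cell_functor_equivalence (D E : PseudoDouble) (F : DoubleMap D E) (G : DoubleMap E D)
  (eta : VertTrans (double_map_id D) (double_map_comp G F))
  (eps : VertTrans (double_map_comp F G) (double_map_id E)) :
  vt_invertible eta -> vt_invertible eps -> is_equivalence (cell_functor F).
Proof.
  intros [_ heta] [_ heps].
  exists (cell_functor G).
  exists (@Build_NatTrans _ _ (functor_id (cell_category D))
    (functor_comp (cell_functor G) (cell_functor F))
    (fun M => vt_hor eta (ha_hor M)) (fun M N a => vt_nat eta a)).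
  exists (@Build_NatTrans _ _ (functor_comp (cell_functor F) (cell_functor G))
    (functor_id (cell_category E))
    (fun M => vt_hor eps (ha_hor M)) (fun M N a => vt_nat eps a)).
  split; [intros M; apply heta | intros M; apply heps].
Qed.

(** * The adjunction between [Int] and [En], and what its invertibility gives *)

Section IntEnAdjunction.
Context (V : BaseCategory).

Lemma int_inj_over_l (I J : small) (M : Mat V I J) i j :
  sp_l (int_hor M) ∘ int_inj M i j = pt V i ∘ bang (M i j).
Proof. exact (int_case_inj (fun i j => pt V i ∘ bang (M i j)) i j). Qed.

Lemma int_inj_over_r (I J : small) (M : Mat V I J) i j :
  sp_r (int_hor M) ∘ int_inj M i j = pt V j ∘ bang (M i j).
Proof. exact (int_case_inj (fun i j => pt V j ∘ bang (M i j)) i j). Qed.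

Lemma en_in_unit (I J : small) (M : Mat V I J) i j :
  en_in (int_hor M) i j ∘ en_lift (int_inj_over_l M i j) (int_inj_over_r M i j) =
  int_inj M i j.
Proof. exact (en_in_lift (int_inj_over_l M i j) (int_inj_over_r M i j)). Qed.

Definition en_int_unit (I J : small) (M : Mat V I J) : MatCell M (en_hor (int_hor M)) :=
  @Build_MatCell V I J I J M (en_hor (int_hor M)) (fun i => i) (fun j => j)
    (fun i j => en_lift (int_inj_over_l M i j) (int_inj_over_r M i j)).

Definition int_en_counit (I J : small) (A : Span V I J) : SpanCell (int_hor (en_hor A)) A.
Proof.
  refine (@Build_SpanCell V I J I J (int_hor (en_hor A)) A (fun i => i) (fun j => j)
    (int_case (fun i j => en_in A i j)) _ _);
  rewrite disc_map_id comp_idl; apply int_ext; intros i j;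
  rewrite -comp_assoc int_case_inj ?int_inj_over_l ?int_inj_over_r; apply en_in_comm.
Defined.

(** A 2-cell out of [int_hor M] is given by cases on the entries of [M], and each case lands over a
    fixed pair of indices, hence factors through the corresponding entry of [en_hor A]. *)
Definition int_en_adjunction :
  Adjunction (cell_functor (Int V)) (cell_functor (En V)).
Proof.
  unshelve refine (@Build_Adjunction _ _ (cell_functor (Int V)) (cell_functor (En V))
    (@Build_NatTrans (cell_category (mat_double V)) (cell_category (mat_double V))
       (functor_id _) (functor_comp (cell_functor (En V)) (cell_functor (Int V)))
       (fun M => en_int_unit (ha_hor M)) _)
    (@Build_NatTrans (cell_category (span_double V)) (cell_category (span_double V))
       (functor_comp (cell_functor (Int V)) (cell_functor (En V))) (functor_id _)
       (fun A => int_en_counit (ha_hor A)) _) _ _).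
  - intros [I J M] [I' J' N] [u v f]; apply mat_cell_eq; intros i j; cbn.
    apply en_ext; rewrite !en_in_lift' -comp_assoc en_in_lift; symmetry.
    apply (int_case_inj (fun i j => int_inj N (u i) (v j) ∘ f i j)).
  - intros [I J A] [I' J' B] a; apply span_cell_eq; [reflexivity|reflexivity|]; cbn.
    apply int_ext; intros i j; unfold int_cell_map.
    rewrite -!comp_assoc !int_case_inj; cbn.
    rewrite int_case_inj'; apply en_in_lift.
  - intros [I J M]; apply span_cell_eq; [reflexivity|reflexivity|]; cbn.
    apply int_ext; intros i j; unfold int_cell_map.
    rewrite -!comp_assoc int_case_inj int_case_inj' comp_idl.
    exact (en_in_unit M i j).
  - intros [I J A]; apply mat_cell_eq; intros i j; cbn.
    apply en_ext; rewrite en_in_lift'; cbn.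
    now rewrite -comp_assoc en_in_lift int_case_inj comp_idr.
Defined.

Lemma mat_cell_inj (I J I' J' : small) (M : Mat V I J) (N : Mat V I' J') (u : I -> I')
  (v : J -> J') (f g : forall i j, Hom (M i j) (N (u i) (v j))) :
  {| mc_l := u; mc_r := v; mc_map := f |} = {| mc_l := u; mc_r := v; mc_map := g |} ->
  forall i j, f i j = g i j.
Proof.
  intros e i j; injection e; intros H.
  (* The type of [mc_map] depends on both boundary maps, so [injection] yields an equality of doubly
     nested dependent pairs. *)
  apply inj_pair2, inj_pair2 in H; now rewrite H.
Qed.

Lemma mat_cell_iso (I J : small) (M N : Mat V I J) (f : forall i j, Hom (M i j) (N i j)) :
  cell_is_iso (D := mat_double V)
    (@Build_MatCell V I J I J M N (fun i => i) (fun j => j) f) ->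
  forall i j, is_iso (f i j).
Proof.
  intros [[u v g] [e1 e2]] i j.
  (* The inverse 2-cell could have any boundary; the inverse equations force it to be the identity,
     so that the entries become comparable. *)
  pose proof (f_equal (@mc_l _ _ _ _ _ _ _) e1 : u = fun i => i) as eu.
  pose proof (f_equal (@mc_r _ _ _ _ _ _ _) e1 : v = fun j => j) as ev.
  subst u v; exists (g i j); split.
  - exact (mat_cell_inj e1 i j).
  - exact (mat_cell_inj e2 i j).
Qed.

Lemma int_en_adjoint_equivalence :
  oplax_double_equivalence (Int V) \/ lax_double_equivalence (En V) ->
  is_adjoint_equivalence int_en_adjunction.
Proof.
  intros [(G & eta & eps & [heta _] & [heps _]) | (G & eta & eps & [heta _] & [heps _])].
  - apply left_adjoint_equivalence, equivalence_weak.
    exact (cell_functor_equivalence heta heps).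
  - apply right_adjoint_equivalence, equivalence_weak.
    exact (cell_functor_equivalence heta heps).
Qed.

(** Taking the second index set to be [unit] turns statements about spans and matrices into
    statements about maps to [disc V I] and families over [I]. *)
Lemma int_en_fibre_decomposition :
  is_adjoint_equivalence int_en_adjunction -> fibre_decomposition V.
Proof.
  intros [hu hc].
  assert (hM : forall (I J : small) (M : Mat V I J) i j,
    is_iso (en_lift (int_inj_over_l M i j) (int_inj_over_r M i j))).
  { intros I J M; apply mat_cell_iso.
    exact (hu (@Build_HorArrow (mat_double V) I J M)). }
  assert (hA : forall (I J : small) (A : Span V I J),
    is_iso (int_case (fun i j => en_in A i j))).
  { intros I J A.
    destruct (hc (@Build_HorArrow (span_double V) I J A)) as [g [e1 e2]].
    exists (sc_map g); split.
    - exact (f_equal (@sc_map _ _ _ _ _ _ _) e1).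
    - exact (f_equal (@sc_map _ _ _ _ _ _ _) e2). }
  pose (S := fun (I : small) (A : V) (f : Hom A (disc V I)) =>
    {| sp_ob := A; sp_l := f; sp_r := pt V tt ∘ bang A |} : Span V I unit).
  assert (S_r : forall (I : small) (A : V) (f : Hom A (disc V I)) Y (x : Hom Y A) t,
    sp_r (S I A f) ∘ x = pt V t ∘ bang Y).
  { intros I A f Y x []; apply comp_bang. }
  pose (MX := fun (I : small) (X : I -> V) => (fun i _ => X i) : Mat V I unit).
  (* [to] and [from] compare the coproduct over [I] with the one over [I * unit], which is how
     [int_fam] indexes the same family. *)
  pose (to := fun (I : small) (X : I -> V) =>
    copair (fun i => int_inj (MX I X) i tt) : Hom (coprod X) (coprod (int_fam (MX I X)))).
  pose (from := fun (I : small) (X : I -> V) =>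
    int_case (M := MX I X) (fun i _ => inj X i) : Hom (coprod (int_fam (MX I X))) (coprod X)).
  assert (to_inj : forall I X i, to I X ∘ inj X i = int_inj (MX I X) i tt)
    by (intros; unfold to; cat).
  assert (from_inj : forall I X i t, from I X ∘ int_inj (MX I X) i t = inj X i)
    by (intros; apply int_case_inj).
  assert (from_to : forall I X, from I X ∘ to I X = idm _).
  { intros I X; apply coprod_ext; intros i.
    now rewrite -comp_assoc to_inj from_inj comp_idl. }
  split.
  - intros I A f X h k e; apply (iso_epi (hA I unit (S I A f))), int_ext; intros i t.
    rewrite -!comp_assoc int_case_inj; apply (e i), (proj1 (en_in_comm (S I A f) i t)).
  - intros I A f X g; destruct (hA I unit (S I A f)) as [r [r1 r2]].
    exists (int_case (fun i t => g i ∘ pb_lift (proj1 (en_in_comm (S I A f) i t))) ∘ r).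
    intros i Y x e.
    pose (y := en_lift (A := S I A f) (j := tt) e (S_r I A f Y x tt)).
    assert (yE : en_in (S I A f) i tt ∘ y = x)
      by exact (en_in_lift (A := S I A f) (j := tt) e (S_r I A f Y x tt)).
    assert (E : r ∘ x = int_inj _ i tt ∘ y).
    { rewrite -(comp_idl (int_inj _ i tt ∘ y)) -r1 -comp_assoc; f_equal.
      now rewrite int_case_inj' yE. }
    rewrite -comp_assoc E int_case_inj' -comp_assoc; f_equal.
    apply pb_ext; cat; [exact yE | apply one_uniq].
  - intros I X i Y x e.
    destruct (hM I unit (MX I X) i tt) as [r [r1 r2]].
    assert (el : sp_l (int_hor (MX I X)) ∘ (to I X ∘ x) = pt V i ∘ bang Y).
    { rewrite -e comp_assoc; f_equal; apply coprod_ext; intros j.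
      now rewrite -comp_assoc to_inj int_inj_over_l summand_index_inj. }
    assert (er : sp_r (int_hor (MX I X)) ∘ (to I X ∘ x) = pt V tt ∘ bang Y).
    { rewrite comp_assoc -(comp_bang (pt V tt) x (bang _)); f_equal.
      apply coprod_ext; intros j.
      now rewrite -comp_assoc to_inj int_inj_over_r comp_bang. }
    exists (r ∘ en_lift el er).
    assert (E : int_inj (MX I X) i tt ∘ r = en_in _ i tt).
    { rewrite -(comp_idr (en_in _ i tt)) -r2 comp_assoc; f_equal.
      symmetry; apply en_in_unit. }
    rewrite -(from_inj I X i tt) -comp_assoc (comp_assoc _ r) E en_in_lift.
    now rewrite comp_assoc from_to comp_idl.
  - intros I X i Y y z e; apply (iso_mono (hM I unit (MX I X) i tt)), en_ext.
    rewrite !comp_assoc en_in_unit -to_inj -!comp_assoc.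
    now f_equal.
Qed.

End IntEnAdjunction.

Lemma conditions_fibre_decomposition (V : BaseCategory) :
  (forall I : small, is_adjoint_equivalence (family_adjunction V I)) \/
  extensive V \/
  oplax_double_equivalence (Int V) \/
  lax_double_equivalence (En V) -> fibre_decomposition V.
Proof.
  intros [h | [h | h]].
  - now apply adjoint_fibre_decomposition.
  - apply adjoint_fibre_decomposition; now apply extensive_adjoint.
  - now apply int_en_fibre_decomposition, int_en_adjoint_equivalence.
Qed.

(** * The enriched category of a discretely internal category *)

Section GeneralizedArrows.
Context (V : BaseCategory) (O : V) (C : InternalCat O).

(* Diagrammatic order: [f] first. *)
Definition ic_mul (Y : V) (f g : Hom Y (ic_arr C)) (e : ic_tgt C ∘ f = ic_src C ∘ g) :
  Hom Y (ic_arr C) := ic_comp C ∘ pb_lift e.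

(** The composability proof depends on the factors and blocks direct rewriting; this congruence
    replaces factors and proof together. *)
Lemma ic_mul_eq (Y : V) (f g f' g' : Hom Y (ic_arr C)) e e' :
  f = f' -> g = g' -> @ic_mul Y f g e = @ic_mul Y f' g' e'.
Proof. intros -> ->; now rewrite (proof_irrelevance _ e e'). Qed.

Lemma ic_mul_pre (X Y : V) (f g : Hom Y (ic_arr C)) e (x : Hom X Y)
  (e' : ic_tgt C ∘ (f ∘ x) = ic_src C ∘ (g ∘ x)) :
  @ic_mul Y f g e ∘ x = ic_mul e'.
Proof. unfold ic_mul; rewrite -comp_assoc; f_equal; apply pb_ext; cat. Qed.

Lemma composable_pre (X Y : V) (f g : Hom Y (ic_arr C)) (x : Hom X Y) :
  ic_tgt C ∘ f = ic_src C ∘ g -> ic_tgt C ∘ (f ∘ x) = ic_src C ∘ (g ∘ x).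
Proof. intros e; now rewrite !comp_assoc e. Qed.

Lemma ic_src_mul (Y : V) (f g : Hom Y (ic_arr C)) e : ic_src C ∘ @ic_mul Y f g e = ic_src C ∘ f.
Proof. unfold ic_mul; now rewrite comp_assoc ic_src_comp -comp_assoc pb1_lift. Qed.

Lemma ic_tgt_mul (Y : V) (f g : Hom Y (ic_arr C)) e : ic_tgt C ∘ @ic_mul Y f g e = ic_tgt C ∘ g.
Proof. unfold ic_mul; now rewrite comp_assoc ic_tgt_comp -comp_assoc pb2_lift. Qed.

Lemma ic_mul_idl (Y : V) (f : Hom Y (ic_arr C)) (o : Hom Y O) e :
  ic_src C ∘ f = o -> @ic_mul Y (ic_id C ∘ o) f e = f.
Proof.
  intros <-.
  assert (e0 : ic_tgt C ∘ (ic_id C ∘ ic_src C) = ic_src C ∘ idm (ic_arr C))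
    by now rewrite comp_assoc ic_tgt_id comp_idl comp_idr.
  rewrite -{3}(comp_idl f) -(ic_idl e0) -comp_assoc; unfold ic_mul; f_equal.
  apply pb_ext; cat.
Qed.

Lemma ic_mul_idr (Y : V) (f : Hom Y (ic_arr C)) (o : Hom Y O) e :
  ic_tgt C ∘ f = o -> @ic_mul Y f (ic_id C ∘ o) e = f.
Proof.
  intros <-.
  assert (e0 : ic_tgt C ∘ idm (ic_arr C) = ic_src C ∘ (ic_id C ∘ ic_tgt C))
    by now rewrite comp_assoc ic_src_id comp_idl comp_idr.
  rewrite -{3}(comp_idl f) -(ic_idr e0) -comp_assoc; unfold ic_mul; f_equal.
  apply pb_ext; cat.
Qed.

(** The axiom [ic_assoc] is the case of the universal composable triple; it is precomposed with the
    map [pb_lift d0] that classifies [f], [g], [h]. *)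
Lemma ic_mul_assoc (Y : V) (f g h : Hom Y (ic_arr C)) e1 e2 e3 e4 :
  @ic_mul Y (@ic_mul Y f g e1) h e2 = @ic_mul Y f (@ic_mul Y g h e3) e4.
Proof.
  assert (d0 : (ic_tgt C ∘ pb2) ∘ pb_lift e1 = ic_src C ∘ h)
    by now rewrite -comp_assoc pb2_lift.
  assert (d1 : ic_tgt C ∘ (ic_comp C ∘ pb1) =
    ic_src C ∘ @pb2 _ _ _ _ (ic_tgt C ∘ pb2) (ic_src C))
    by now rewrite comp_assoc ic_tgt_comp pb_comm.
  assert (d2 : ic_tgt C ∘ (pb2 ∘ pb1) =
    ic_src C ∘ @pb2 _ _ _ _ (ic_tgt C ∘ @pb2 _ _ _ _ (ic_tgt C) (ic_src C)) (ic_src C))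
    by now rewrite comp_assoc pb_comm.
  assert (d3 : ic_tgt C ∘ (pb1 ∘ pb1) = ic_src C ∘ (ic_comp C ∘ pb_lift d2))
    by now rewrite (comp_assoc (ic_src C)) ic_src_comp -comp_assoc pb1_lift !comp_assoc pb_comm.
  pose proof (f_equal (fun k => k ∘ pb_lift d0) (ic_assoc d1 d3)) as e; cbn in e.
  rewrite -!comp_assoc in e.
  transitivity (ic_comp C ∘ (pb_lift d1 ∘ pb_lift d0)); [|rewrite e];
    unfold ic_mul; f_equal; apply pb_ext; cat.
  unfold ic_mul; f_equal; apply pb_ext; cat.
Qed.

Lemma if_mul (P : V) (D : InternalCat P) (u : Hom O P) (F : InternalFunctor C D u)
  (Y : V) (f g : Hom Y (ic_arr C)) e
  (e' : ic_tgt D ∘ (if_map F ∘ f) = ic_src D ∘ (if_map F ∘ g)) :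
  if_map F ∘ @ic_mul Y f g e = ic_comp D ∘ pb_lift e'.
Proof.
  unfold ic_mul; rewrite comp_assoc (if_comp (internal_functor_composable F)) -comp_assoc.
  f_equal; apply pb_ext; cat.
Qed.

End GeneralizedArrows.

(** * Hom objects as fibres of the object of arrows *)

Section Externalization.
Context (V : BaseCategory).

Definition dc_span (C : DiscCat V) : Span V (dc_ob C) (dc_ob C) :=
  {| sp_ob := ic_arr (dc_cat C); sp_l := ic_src (dc_cat C); sp_r := ic_tgt (dc_cat C) |}.

(** Typed with [ic_arr], so that the laws of the internal category apply without unfolding
    [dc_span]. *)
Definition hom_in (C : DiscCat V) (a b : dc_ob C) :
  Hom (en_hor (dc_span C) a b) (ic_arr (dc_cat C)) := en_in (dc_span C) a b.

Section Objects.
Context (C : DiscCat V).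
Implicit Types a b c d : dc_ob C.

Lemma hom_in_src a b : ic_src (dc_cat C) ∘ hom_in a b = pt V a ∘ bang _.
Proof. exact (proj1 (en_in_comm (dc_span C) a b)). Qed.

Lemma hom_in_tgt a b : ic_tgt (dc_cat C) ∘ hom_in a b = pt V b ∘ bang _.
Proof. exact (proj2 (en_in_comm (dc_span C) a b)). Qed.

Lemma hom_in_src' a b Y (x : Hom Y (en_hor (dc_span C) a b)) :
  ic_src (dc_cat C) ∘ (hom_in a b ∘ x) = pt V a ∘ bang Y.
Proof. now rewrite comp_assoc hom_in_src comp_bang. Qed.

Lemma hom_in_tgt' a b Y (x : Hom Y (en_hor (dc_span C) a b)) :
  ic_tgt (dc_cat C) ∘ (hom_in a b ∘ x) = pt V b ∘ bang Y.
Proof. now rewrite comp_assoc hom_in_tgt comp_bang. Qed.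

Definition hom_lift a b Y (x : Hom Y (ic_arr (dc_cat C)))
  (es : ic_src (dc_cat C) ∘ x = pt V a ∘ bang Y)
  (et : ic_tgt (dc_cat C) ∘ x = pt V b ∘ bang Y) : Hom Y (en_hor (dc_span C) a b) :=
  en_lift (A := dc_span C) es et.

Lemma hom_in_lift a b Y (x : Hom Y (ic_arr (dc_cat C))) es et :
  hom_in a b ∘ @hom_lift a b Y x es et = x.
Proof. exact (en_in_lift (A := dc_span C) es et). Qed.

Lemma hom_in_mono a b Y (x y : Hom Y (en_hor (dc_span C) a b)) :
  hom_in a b ∘ x = hom_in a b ∘ y -> x = y.
Proof. exact (@en_ext V _ _ (dc_span C) a b Y x y). Qed.

Lemma hom_composable a b c Y (y : Hom Y (en_hor (dc_span C) b c))
  (x : Hom Y (en_hor (dc_span C) a b)) :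
  ic_tgt (dc_cat C) ∘ (hom_in a b ∘ x) = ic_src (dc_cat C) ∘ (hom_in b c ∘ y).
Proof. now rewrite hom_in_tgt' hom_in_src'. Qed.

(** The arguments come in the enriched order, [y] after [x], and are exchanged for the diagrammatic
    [ic_mul]. *)
Definition hom_mul a b c Y (y : Hom Y (en_hor (dc_span C) b c))
  (x : Hom Y (en_hor (dc_span C) a b)) : Hom Y (ic_arr (dc_cat C)) :=
  ic_mul (hom_composable y x).

Lemma hom_mul_src a b c Y (y : Hom Y (en_hor (dc_span C) b c))
  (x : Hom Y (en_hor (dc_span C) a b)) :
  ic_src (dc_cat C) ∘ hom_mul y x = pt V a ∘ bang Y.
Proof. unfold hom_mul; rewrite ic_src_mul; apply hom_in_src'. Qed.

Lemma hom_mul_tgt a b c Y (y : Hom Y (en_hor (dc_span C) b c))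
  (x : Hom Y (en_hor (dc_span C) a b)) :
  ic_tgt (dc_cat C) ∘ hom_mul y x = pt V c ∘ bang Y.
Proof. unfold hom_mul; rewrite ic_tgt_mul; apply hom_in_tgt'. Qed.

Definition hom_comp a b c :
  Hom (times (en_hor (dc_span C) b c) (en_hor (dc_span C) a b)) (en_hor (dc_span C) a c) :=
  hom_lift (hom_mul_src pr1 pr2) (hom_mul_tgt pr1 pr2).

Lemma hom_in_comp a b c Y (y : Hom Y (en_hor (dc_span C) b c))
  (x : Hom Y (en_hor (dc_span C) a b)) :
  hom_in a c ∘ (hom_comp a b c ∘ pair y x) = hom_mul y x.
Proof.
  rewrite comp_assoc hom_in_lift; unfold hom_mul.
  unshelve erewrite ic_mul_pre; [apply composable_pre, hom_composable|].
  apply ic_mul_eq; cat.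
Qed.

Lemma ic_id_src a : ic_src (dc_cat C) ∘ (ic_id (dc_cat C) ∘ pt V a) = pt V a ∘ bang one.
Proof.
  rewrite comp_assoc ic_src_id comp_idl -{1}(comp_idr (pt V a)); f_equal; apply one_uniq.
Qed.

Lemma ic_id_tgt a : ic_tgt (dc_cat C) ∘ (ic_id (dc_cat C) ∘ pt V a) = pt V a ∘ bang one.
Proof.
  rewrite comp_assoc ic_tgt_id comp_idl -{1}(comp_idr (pt V a)); f_equal; apply one_uniq.
Qed.

Definition hom_id a : Hom one (en_hor (dc_span C) a a) := hom_lift (ic_id_src a) (ic_id_tgt a).

Lemma hom_in_id a Y (t : Hom Y one) :
  hom_in a a ∘ (hom_id a ∘ t) = ic_id (dc_cat C) ∘ (pt V a ∘ bang Y).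
Proof.
  unfold hom_id; rewrite comp_assoc hom_in_lift -comp_assoc (one_uniq t (bang Y)).
  reflexivity.
Qed.

Lemma hom_in_idE a : hom_in a a ∘ hom_id a = ic_id (dc_cat C) ∘ pt V a.
Proof. apply hom_in_lift. Qed.

(** Since [hom_in] is monic, enriched laws can be checked in the object of arrows. The change of
    order exchanges the two bracketings. *)
Lemma hom_comp_assoc a b c d Y (z : Hom Y (en_hor (dc_span C) c d))
  (y : Hom Y (en_hor (dc_span C) b c)) (x : Hom Y (en_hor (dc_span C) a b)) :
  hom_comp a b d ∘ pair (hom_comp b c d ∘ pair z y) x =
  hom_comp a c d ∘ pair z (hom_comp a b c ∘ pair y x).
Proof.
  apply hom_in_mono; rewrite !hom_in_comp.
  assert (e1 : ic_tgt (dc_cat C) ∘ (hom_in a b ∘ x) = ic_src (dc_cat C) ∘ hom_mul z y)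
    by now rewrite hom_mul_src hom_in_tgt'.
  assert (e2 : ic_tgt (dc_cat C) ∘ hom_mul y x = ic_src (dc_cat C) ∘ (hom_in c d ∘ z))
    by now rewrite hom_mul_tgt hom_in_src'.
  transitivity (ic_mul e1); [apply ic_mul_eq; [reflexivity | apply hom_in_comp]|].
  transitivity (ic_mul e2); [symmetry; apply ic_mul_assoc|].
  apply ic_mul_eq; [symmetry; apply hom_in_comp | reflexivity].
Qed.

(** In diagrammatic order the identity is the second factor, hence the use of [ic_mul_idr]. *)
Lemma hom_comp_idl a b Y (t : Hom Y one) (x : Hom Y (en_hor (dc_span C) a b)) :
  hom_comp a b b ∘ pair (hom_id b ∘ t) x = x.
Proof.
  apply hom_in_mono; rewrite hom_in_comp.
  assert (e : ic_tgt (dc_cat C) ∘ (hom_in a b ∘ x) =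
    ic_src (dc_cat C) ∘ (ic_id (dc_cat C) ∘ (pt V b ∘ bang Y)))
    by now rewrite (comp_assoc (ic_src _)) ic_src_id comp_idl hom_in_tgt'.
  transitivity (ic_mul e); [apply ic_mul_eq; [reflexivity | apply hom_in_id]|].
  apply ic_mul_idr, hom_in_tgt'.
Qed.

Lemma hom_comp_idr a b Y (t : Hom Y one) (x : Hom Y (en_hor (dc_span C) a b)) :
  hom_comp a a b ∘ pair x (hom_id a ∘ t) = x.
Proof.
  apply hom_in_mono; rewrite hom_in_comp.
  assert (e : ic_tgt (dc_cat C) ∘ (ic_id (dc_cat C) ∘ (pt V a ∘ bang Y)) =
    ic_src (dc_cat C) ∘ (hom_in a b ∘ x))
    by now rewrite (comp_assoc (ic_tgt _)) ic_tgt_id comp_idl hom_in_src'.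
  transitivity (ic_mul e); [apply ic_mul_eq; [apply hom_in_id | reflexivity]|].
  apply ic_mul_idl, hom_in_src'.
Qed.

Definition externalize_ob : EnrichedCat V.
Proof.
  unshelve refine {| ec_ob := dc_ob C; ec_hom := en_hor (dc_span C);
    ec_comp := hom_comp; ec_id := hom_id |}; intros; unfold tmap, tassoc.
  - repeat rewrite ?pair_comp -?comp_assoc ?pr1_pair ?pr2_pair ?comp_idl.
    now rewrite -hom_comp_assoc pair_eta.
  - rewrite comp_idl; apply hom_comp_idl.
  - rewrite comp_idl; apply hom_comp_idr.
Defined.

End Objects.

Section Functors.
Context (C D : DiscCat V) (F : DiscFunctor C D).

Lemma if_hom_in_src a b : ic_src (dc_cat D) ∘ (if_map (df_functor F) ∘ hom_in a b) =
  pt V (df_ob F a) ∘ bang _.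
Proof. now rewrite comp_assoc if_src -comp_assoc hom_in_src disc_map_pt'. Qed.

Lemma if_hom_in_tgt a b : ic_tgt (dc_cat D) ∘ (if_map (df_functor F) ∘ hom_in a b) =
  pt V (df_ob F b) ∘ bang _.
Proof. now rewrite comp_assoc if_tgt -comp_assoc hom_in_tgt disc_map_pt'. Qed.

Definition hom_map a b :
  Hom (en_hor (dc_span C) a b) (en_hor (dc_span D) (df_ob F a) (df_ob F b)) :=
  hom_lift (if_hom_in_src a b) (if_hom_in_tgt a b).

Lemma hom_in_map a b : hom_in _ _ ∘ hom_map a b = if_map (df_functor F) ∘ hom_in a b.
Proof. apply hom_in_lift. Qed.

Definition externalize_hom : EnrichedFunctor (externalize_ob C) (externalize_ob D).
Proof.
  unshelve refine (@Build_EnrichedFunctor V (externalize_ob C) (externalize_ob D)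
    (df_ob F) hom_map _ _); cbn.
  - intros a b c; apply hom_in_mono; unfold tmap.
    (* Inserting the identity as [pair pr1 pr2] writes the bare composition as a product of
       generalized elements. *)
    rewrite hom_in_comp comp_assoc hom_in_map -(comp_idr (hom_comp a b c)) -pair_pr.
    rewrite -comp_assoc hom_in_comp; unfold hom_mul.
    unshelve erewrite if_mul.
    { rewrite !comp_assoc if_src if_tgt -!comp_assoc; f_equal; apply hom_composable. }
    apply ic_mul_eq; now rewrite comp_assoc -hom_in_map -comp_assoc.
  - intros a; apply hom_in_mono.
    rewrite comp_assoc hom_in_map -comp_assoc !hom_in_idE.
    now rewrite comp_assoc if_id -comp_assoc disc_map_pt.
Defined.

End Functors.

Definition externalize : Functor (CatD V) (VCat V).
Proof.
  unshelve refine (@Build_Functor (CatD V) (VCat V) externalize_ob externalize_hom _ _).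
  - intros C; apply enriched_functor_eq; intros a b; apply hom_in_mono.
    etransitivity; [exact (hom_in_map (disc_functor_id C) a b)|].
    cbn; now rewrite comp_idl comp_idr.
  - intros C D E G F; apply enriched_functor_eq; intros a b; apply hom_in_mono.
    etransitivity; [exact (hom_in_map (disc_functor_comp G F) a b)|]; cbn.
    now rewrite (comp_assoc _ (hom_map G _ _)) hom_in_map -!comp_assoc hom_in_map.
Defined.

End Externalization.

(** * Fullness, faithfulness and essential surjectivity *)

Section PairedIndices.
Context (V : BaseCategory) (I J : small).

(* Cartesian closedness gives the comparison [(I • 1) × (J • 1) -> (I × J) • 1].  The
   construction is sealed because rewriting with [comp_assoc] would otherwise unfold it. *)
Lemma disc_pair_sig : {d : Hom (times (disc V I) (disc V J)) (disc V (I * J)%type) |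
  forall i j (Y : V) (x y : Hom Y one),
    d ∘ pair (pt V i ∘ x) (pt V j ∘ y) = pt V (i, j) ∘ bang Y}.
Proof.
  exists (casel (X := fun _ : I => one) (fun i =>
    caser (X := fun _ : J => one) (fun j => pt V (i, j) ∘ bang (times one one)))).
  intros i j Y x y; unfold pt; rewrite (casel_inj (X := fun _ : I => one)).
  rewrite (caser_inj (X := fun _ : J => one)); apply comp_bang.
Qed.

Definition disc_pair : Hom (times (disc V I) (disc V J)) (disc V (I * J)%type) :=
  proj1_sig disc_pair_sig.

Lemma disc_pair_pt (i : I) (j : J) (Y : V) (x y : Hom Y one) :
  disc_pair ∘ pair (pt V i ∘ x) (pt V j ∘ y) = pt V (i, j) ∘ bang Y.
Proof. apply (proj2_sig disc_pair_sig). Qed.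

Lemma disc_map_fst_pair : disc_map V fst ∘ disc_pair = pr1.
Proof.
  apply (casel_ext (X := fun _ : I => one)); intros i.
  apply (caser_ext (X := fun _ : J => one)); intros j.
  rewrite -!comp_assoc !pair_comp pr1_pair -!comp_assoc pr1_pair pr2_pair.
  etransitivity; [exact (f_equal (comp _) (disc_pair_pt i j _ _))|].
  rewrite disc_map_pt'; unfold pt; f_equal; apply one_uniq.
Qed.

Lemma disc_map_snd_pair : disc_map V snd ∘ disc_pair = pr2.
Proof.
  apply (casel_ext (X := fun _ : I => one)); intros i.
  apply (caser_ext (X := fun _ : J => one)); intros j.
  rewrite -!comp_assoc !pair_comp pr2_pair -!comp_assoc pr1_pair pr2_pair.
  etransitivity; [exact (f_equal (comp _) (disc_pair_pt i j _ _))|].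
  rewrite disc_map_pt'; unfold pt; f_equal; apply one_uniq.
Qed.

(** Merges two index maps into one. The coordinates are recovered by composing [disc_pair] with
    [disc_map V fst] and [disc_map V snd]. *)
Lemma lies_over_pair (A : V) (l : Hom A (disc V I)) (r : Hom A (disc V J)) i j
  (Y : V) (x : Hom Y A) :
  lies_over (disc_pair ∘ pair l r) (i, j) x <-> lies_over l i x /\ lies_over r j x.
Proof.
  unfold lies_over; split.
  - intros e; split.
    + rewrite -(pr1_pair l r) -disc_map_fst_pair -!comp_assoc.
      now rewrite (comp_assoc _ (pair l r)) e disc_map_pt'.
    + rewrite -(pr2_pair l r) -disc_map_snd_pair -!comp_assoc.
      now rewrite (comp_assoc _ (pair l r)) e disc_map_pt'.
  - intros [el er]; rewrite -comp_assoc pair_comp el er; apply disc_pair_pt.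
Qed.

End PairedIndices.

(** * Maps determined and constructed on fibres over pairs and triples *)

Section Decomposition.
Context (V : BaseCategory) (H : fibre_decomposition V).

Lemma lies_over_comp (I : small) (A : V) (f : Hom A (disc V I)) i Y Z (x : Hom Y A)
  (y : Hom Z Y) : lies_over f i x -> lies_over f i (x ∘ y).
Proof. unfold lies_over; intros e; now rewrite comp_assoc e comp_bang. Qed.

Lemma lies_over_assoc (I : small) (A B : V) (f : Hom B (disc V I)) (g : Hom A B) i Y
  (x : Hom Y A) : lies_over (f ∘ g) i x <-> lies_over f i (g ∘ x).
Proof. unfold lies_over; now rewrite comp_assoc. Qed.

(** Decompose along [l], then decompose each piece along the restriction of [r]. *)
Lemma fibre_ext2 (I J : small) (A : V) (l : Hom A (disc V I)) (r : Hom A (disc V J)) (X : V)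
  (h k : Hom A X) :
  (forall i j Y (x : Hom Y A), lies_over l i x -> lies_over r j x -> h ∘ x = k ∘ x) -> h = k.
Proof.
  intros e; apply (fibre_ext H (f := l)); intros i Y x ex.
  apply (fibre_ext H (f := r ∘ x)); intros j Z y ey.
  rewrite -!comp_assoc; apply (e i j); [now apply lies_over_comp|].
  now apply lies_over_assoc.
Qed.

Lemma span_ext (I J : small) (A : Span V I J) (X : V) (h k : Hom (sp_ob A) X) :
  (forall i j, h ∘ en_in A i j = k ∘ en_in A i j) -> h = k.
Proof.
  intros e; apply (fibre_ext2 (l := sp_l A) (r := sp_r A)); intros i j Y x el er.
  rewrite -(en_in_lift el er) !comp_assoc; now rewrite e.
Qed.

(** Definition by cases uses a single index map, so the legs are merged by [disc_pair]; the fibre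
    over [(i, j)] maps to the entry [en_hor A i j] by [en_lift]. *)
Lemma span_case (I J : small) (A : Span V I J) (X : V) (g : forall i j, Hom (en_hor A i j) X) :
  exists h : Hom (sp_ob A) X, forall i j, h ∘ en_in A i j = g i j.
Proof.
  set (f := disc_pair V I J ∘ pair (sp_l A) (sp_r A)).
  assert (over : forall i j, lies_over (sp_l A) i (@pb1 _ _ _ _ f (pt V (i, j))) /\
    lies_over (sp_r A) j (@pb1 _ _ _ _ f (pt V (i, j)))).
  { intros i j; apply lies_over_pair, lies_over_pb1. }
  destruct (fibre_case H (f := f)
    (fun p => match p return Hom (pb f (pt V p)) X with
      | (i, j) => g i j ∘ en_lift (proj1 (over i j)) (proj2 (over i j)) end)) as [h hE].
  exists h; intros i j.
  assert (e : lies_over f (i, j) (en_in A i j)).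
  { destruct (en_in_comm A i j); now apply lies_over_pair. }
  rewrite (hE _ _ _ e) -comp_assoc -{2}(comp_idr (g i j)); f_equal.
  apply en_ext; rewrite en_in_lift'; cat.
Qed.

(** The outer endpoints and the common middle object give three index maps on the pullback. The
    outer two are separated first, the middle one afterwards. *)
Lemma composable_ext (I J K : small) (A B X : V) (sA : Hom A (disc V I))
  (tA : Hom A (disc V J)) (sB : Hom B (disc V J)) (tB : Hom B (disc V K))
  (h k : Hom (pb tA sB) X) :
  (forall i j l Y (x : Hom Y A) (y : Hom Y B) (e : tA ∘ x = sB ∘ y),
    lies_over sA i x -> lies_over tA j x -> lies_over sB j y -> lies_over tB l y ->
    h ∘ pb_lift e = k ∘ pb_lift e) -> h = k.
Proof.
  intros E; apply (fibre_ext2 (l := sA ∘ pb1) (r := tB ∘ pb2)); intros i l Y x el er.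
  apply (fibre_ext H (f := tA ∘ pb1 ∘ x)); intros j Z y ey.
  unfold lies_over in ey; rewrite -!comp_assoc in ey.
  assert (e : tA ∘ (pb1 ∘ (x ∘ y)) = sB ∘ (pb2 ∘ (x ∘ y)))
    by now rewrite !comp_assoc pb_comm.
  assert (xyE : x ∘ y = pb_lift e) by (apply pb_ext; cat).
  rewrite -!comp_assoc xyE; apply (E i j l).
  - now apply lies_over_assoc, lies_over_comp.
  - exact ey.
  - unfold lies_over; now rewrite -e.
  - now apply lies_over_assoc, lies_over_comp.
Qed.

(** Merging the legs of [int_hor M] by [disc_pair] gives exactly the summand index of the family
    over [I * J]. *)
Lemma int_lift (I J : small) (M : Mat V I J) i j Y (x : Hom Y (sp_ob (int_hor M))) :
  lies_over (sp_l (int_hor M)) i x -> lies_over (sp_r (int_hor M)) j x ->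
  exists y : Hom Y (M i j), x = int_inj M i j ∘ y.
Proof.
  intros el er; apply (summand_lift H (X := int_fam M) (i := (i, j))).
  assert (E : disc_pair V I J ∘ pair (sp_l (int_hor M)) (sp_r (int_hor M)) =
    summand_index (int_fam M)).
  { apply int_ext; intros i' j'.
    rewrite -comp_assoc pair_comp int_inj_over_l int_inj_over_r disc_pair_pt.
    symmetry; apply (summand_index_inj (int_fam M) (i', j')). }
  rewrite -E; now apply lies_over_pair.
Qed.

Lemma int_inj_mono (I J : small) (M : Mat V I J) i j Y (y z : Hom Y (M i j)) :
  int_inj M i j ∘ y = int_inj M i j ∘ z -> y = z.
Proof. apply (summand_mono H (X := int_fam M) (i := (i, j))). Qed.

(** * Faithfulness and fullness of [externalize] *)

Lemma externalize_faithful : faithful (externalize V).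
Proof.
  intros C D F G e; apply disc_functor_eq.
  - exact (f_equal (@ef_ob _ _ _) e).
  - apply (span_ext (A := dc_span C)); intros a b.
    (* The type of [ef_map] varies with the object part; composing with [hom_in] lands in the fixed
       object [ic_arr (dc_cat D)], so no transport arises. *)
    pose proof (f_equal (fun E : EnrichedFunctor (externalize_ob C) (externalize_ob D) =>
      hom_in (C := D) (ef_ob E a) (ef_ob E b) ∘ ef_map E a b) e) as E; cbn in E.
    now rewrite !hom_in_map in E.
Qed.

(** The components on hom objects are glued by [span_case] to a map [h] of objects of arrows; each
    law of an internal functor is then checked fibrewise. *)
Lemma externalize_full : full (externalize V).
Proof.
  intros C D [u m mc mi]; cbn in u, m, mc, mi.
  destruct (span_case (A := dc_span C) (fun a b => hom_in (C := D) (u a) (u b) ∘ m a b))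
    as [h hE]; cbn in h.
  assert (h_in : forall a b, h ∘ hom_in (C := C) a b = hom_in (C := D) (u a) (u b) ∘ m a b) by exact hE.
  assert (h_src : ic_src (dc_cat D) ∘ h = disc_map V u ∘ ic_src (dc_cat C)).
  { apply (span_ext (A := dc_span C)); intros a b.
    change (en_in (dc_span C) a b) with (hom_in (C := C) a b).
    now rewrite -!comp_assoc h_in hom_in_src' hom_in_src disc_map_pt'. }
  assert (h_tgt : ic_tgt (dc_cat D) ∘ h = disc_map V u ∘ ic_tgt (dc_cat C)).
  { apply (span_ext (A := dc_span C)); intros a b.
    change (en_in (dc_span C) a b) with (hom_in (C := C) a b).
    now rewrite -!comp_assoc h_in hom_in_tgt' hom_in_tgt disc_map_pt'. }
  assert (h_id : h ∘ ic_id (dc_cat C) = ic_id (dc_cat D) ∘ disc_map V u).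
  { apply (coprod_ext (X := fun _ => one)); intros a.
    change (inj (fun _ => one) a) with (pt V a).
    rewrite -!comp_assoc disc_map_pt -(hom_in_idE (C := C)) (comp_assoc h) h_in.
    rewrite -comp_assoc mi; apply hom_in_idE. }
  assert (h_comp : forall e : ic_tgt (dc_cat D) ∘ (h ∘ pb1) = ic_src (dc_cat D) ∘ (h ∘ pb2),
    h ∘ ic_comp (dc_cat C) = ic_comp (dc_cat D) ∘ pb_lift e).
  { intros e.
    apply (composable_ext (sA := ic_src (dc_cat C)) (tB := ic_tgt (dc_cat C))).
    intros a b c Y x y exy x1 x2 y1 y2.
    (* Once all endpoints are fixed, both arrows factor through hom objects and [mc] applies. *)
    pose (x' := hom_lift x1 x2); pose (y' := hom_lift y1 y2).
    assert (xE : hom_in (C := C) a b ∘ x' = x) by apply hom_in_lift.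
    assert (yE : hom_in (C := C) b c ∘ y' = y) by apply hom_in_lift.
    clearbody x' y'; subst x y.
    transitivity (h ∘ hom_mul y' x').
    { rewrite -comp_assoc; f_equal; apply ic_mul_eq; reflexivity. }
    rewrite -hom_in_comp comp_assoc h_in -comp_assoc (comp_assoc (m a c)) mc.
    unfold tmap; rewrite -comp_assoc pair_comp -!comp_assoc pr1_pair pr2_pair hom_in_comp.
    unfold hom_mul, ic_mul; f_equal; apply pb_ext; cat;
      now rewrite !comp_assoc h_in. }
  exists (@Build_DiscFunctor V C D u
    (@Build_InternalFunctor V _ _ (dc_cat C) (dc_cat D) (disc_map V u) h h_src h_tgt h_id h_comp)).
  apply enriched_functor_eq; intros a b; apply hom_in_mono.
  etransitivity; [apply hom_in_lift|]; apply h_in.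
Qed.

End Decomposition.

(** * Essential surjectivity: the internal category built from an enriched one *)

Section EnrichedElements.
Context (V : BaseCategory) (E : EnrichedCat V).

(** Precomposing the axiom with a pairing yields its form for generalized elements; the unit laws
    below are obtained likewise. *)
Lemma ec_comp_assoc (a b c d : ec_ob E) Y (x : Hom Y (ec_hom a b)) (y : Hom Y (ec_hom b c))
  (z : Hom Y (ec_hom c d)) :
  ec_comp a b d ∘ pair (ec_comp b c d ∘ pair z y) x =
  ec_comp a c d ∘ pair z (ec_comp a b c ∘ pair y x).
Proof.
  pose proof (f_equal (fun h => h ∘ pair (pair z y) x) (ec_assoc a b c d)) as e.
  revert e; unfold tmap, tassoc.
  now repeat rewrite ?pair_comp -?comp_assoc ?pr1_pair ?pr2_pair ?comp_idl.
Qed.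

Lemma ec_comp_idl (a b : ec_ob E) Y (t : Hom Y one) (x : Hom Y (ec_hom a b)) :
  ec_comp a b b ∘ pair (ec_id b ∘ t) x = x.
Proof.
  pose proof (f_equal (fun h => h ∘ pair t x) (ec_idl a b)) as e.
  revert e; unfold tmap.
  now repeat rewrite ?pair_comp -?comp_assoc ?pr1_pair ?pr2_pair ?comp_idl.
Qed.

Lemma ec_comp_idr (a b : ec_ob E) Y (t : Hom Y one) (x : Hom Y (ec_hom a b)) :
  ec_comp a a b ∘ pair x (ec_id a ∘ t) = x.
Proof.
  pose proof (f_equal (fun h => h ∘ pair x t) (ec_idr a b)) as e.
  revert e; unfold tmap.
  now repeat rewrite ?pair_comp -?comp_assoc ?pr1_pair ?pr2_pair ?comp_idl.
Qed.

End EnrichedElements.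

Section Internalization.
Context (V : BaseCategory) (H : fibre_decomposition V) (E : EnrichedCat V).

Local Notation M := (fun a b : ec_ob E => ec_hom a b).
Local Notation arr := (sp_ob (int_hor M)).
Local Notation src := (sp_l (int_hor M)).
Local Notation tgt := (sp_r (int_hor M)).

Lemma int_inj_src (a b : ec_ob E) Y (x : Hom Y (ec_hom a b)) :
  src ∘ (int_inj M a b ∘ x) = pt V a ∘ bang Y.
Proof. now rewrite comp_assoc int_inj_over_l comp_bang. Qed.

Lemma int_inj_tgt (a b : ec_ob E) Y (x : Hom Y (ec_hom a b)) :
  tgt ∘ (int_inj M a b ∘ x) = pt V b ∘ bang Y.
Proof. now rewrite comp_assoc int_inj_over_r comp_bang. Qed.

(** Composable pairs are indexed by triples of objects, and over each triple [mu] is enriched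
    composition. The restriction [w] allows [f] and [g] to meet several summands and to factor
    through one only after restriction, as nested composites require. *)
Lemma internal_comp_sig :
  exists mu : Hom (pb tgt src) arr, forall a b c Y W (w : Hom Y W) (f g : Hom W arr)
    (e : tgt ∘ f = src ∘ g) (x : Hom Y (ec_hom a b)) (y : Hom Y (ec_hom b c)),
    f ∘ w = int_inj M a b ∘ x -> g ∘ w = int_inj M b c ∘ y ->
    mu ∘ (pb_lift e ∘ w) = int_inj M a c ∘ (ec_comp a b c ∘ pair y x).
Proof.
  set (ix := disc_pair V _ _ ∘ pair (src ∘ pb1) (disc_pair V _ _ ∘ pair (tgt ∘ pb1) (tgt ∘ pb2))
    : Hom (pb tgt src) (disc V (ec_ob E * (ec_ob E * ec_ob E))%type)).
  assert (over : forall a b c Y (x : Hom Y (pb tgt src)), lies_over ix (a, (b, c)) x <->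
    src ∘ (pb1 ∘ x) = pt V a ∘ bang Y /\ tgt ∘ (pb1 ∘ x) = pt V b ∘ bang Y /\
    tgt ∘ (pb2 ∘ x) = pt V c ∘ bang Y).
  { intros a b c Y x; unfold ix; rewrite !lies_over_pair !lies_over_assoc; reflexivity. }
  (* Over a fixed triple both projections land in single summands. The lifts are chosen as data
     because [fibre_case] takes a family of maps. *)
  assert (lift : forall a b c,
    {x : Hom (pb ix (pt V (a, (b, c)))) (ec_hom a b) | pb1 ∘ pb1 = int_inj M a b ∘ x} *
    {y : Hom (pb ix (pt V (a, (b, c)))) (ec_hom b c) | pb2 ∘ pb1 = int_inj M b c ∘ y}).
  { intros a b c.
    destruct (proj1 (over a b c _ pb1) (lies_over_pb1 ix _)) as (o1 & o2 & o3).
    split; apply constructive_indefinite_description; apply (int_lift H); try assumption.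
    unfold lies_over; rewrite -o2 !comp_assoc; f_equal; symmetry; apply pb_comm. }
  destruct (fibre_case H (f := ix)
    (fun p => match p return Hom (pb ix (pt V p)) arr with
      | (a, (b, c)) => int_inj M a c ∘ (ec_comp a b c ∘
          pair (proj1_sig (snd (lift a b c))) (proj1_sig (fst (lift a b c)))) end)) as [mu muE].
  exists mu; intros a b c Y W w f g e x y ef eg.
  assert (o : lies_over ix (a, (b, c)) (pb_lift e ∘ w)).
  { apply over; rewrite !(comp_assoc _ (pb_lift e)) pb1_lift pb2_lift ef eg.
    now rewrite int_inj_src !int_inj_tgt. }
  rewrite (muE _ _ _ o).
  (* Summand injections are monic, so the chosen lifts restrict to [x] and [y]. *)
  destruct (lift a b c) as [[x' x'E] [y' y'E]]; cbn.
  rewrite -!comp_assoc pair_comp; do 2 f_equal; f_equal; apply (int_inj_mono H (M := M));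
    rewrite comp_assoc -?x'E -?y'E; cat; assumption.
Qed.

Lemma int_composable_ext (X : V) (h k : Hom (pb tgt src) X) :
  (forall a b c Y (w : Hom Y (pb tgt src)) (x : Hom Y (ec_hom a b)) (y : Hom Y (ec_hom b c)),
    pb1 ∘ w = int_inj M a b ∘ x -> pb2 ∘ w = int_inj M b c ∘ y -> h ∘ w = k ∘ w) -> h = k.
Proof.
  intros e; apply (composable_ext H (sA := src) (tB := tgt)).
  intros a b c Y x y exy x1 x2 y1 y2.
  destruct (int_lift H x1 x2) as [x' x'E]; destruct (int_lift H y1 y2) as [y' y'E].
  apply (e a b c Y _ x' y'); cat; assumption.
Qed.

(** The composition is a section variable because its existence is only a proposition, while the
    internal category is data. *)
Context (mu : Hom (pb tgt src) arr)
  (muE : forall a b c Y W (w : Hom Y W) (f g : Hom W arr)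
    (e : tgt ∘ f = src ∘ g) (x : Hom Y (ec_hom a b)) (y : Hom Y (ec_hom b c)),
    f ∘ w = int_inj M a b ∘ x -> g ∘ w = int_inj M b c ∘ y ->
    mu ∘ (pb_lift e ∘ w) = int_inj M a c ∘ (ec_comp a b c ∘ pair y x)).

Lemma mu_pair (a b c : ec_ob E) Y (w : Hom Y (pb tgt src)) (x : Hom Y (ec_hom a b))
  (y : Hom Y (ec_hom b c)) :
  pb1 ∘ w = int_inj M a b ∘ x -> pb2 ∘ w = int_inj M b c ∘ y ->
  mu ∘ w = int_inj M a c ∘ (ec_comp a b c ∘ pair y x).
Proof.
  intros ex ey; rewrite -(muE pb_comm ex ey); f_equal; apply pb_ext; cat.
Qed.

Definition internal_id : Hom (disc V (ec_ob E)) arr :=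
  copair (X := fun _ => one) (fun a => int_inj M a a ∘ ec_id a).

Lemma internal_id_pt (a : ec_ob E) Y (t : Hom Y one) :
  internal_id ∘ (pt V a ∘ t) = int_inj M a a ∘ (ec_id a ∘ t).
Proof.
  rewrite !comp_assoc; f_equal; unfold internal_id, pt.
  exact (copair_inj (X := fun _ => one) (fun a => int_inj M a a ∘ ec_id a) a).
Qed.

Definition internalize_cat : InternalCat (disc V (ec_ob E)).
Proof.
  refine {| ic_arr := arr; ic_src := src; ic_tgt := tgt; ic_id := internal_id; ic_comp := mu |}.
  - apply (coprod_ext (X := fun _ => one)); intros a.
    change (inj (fun _ => one) a) with (pt V a).
    rewrite comp_idl -(comp_idr (pt V a)) -comp_assoc internal_id_pt int_inj_src.
    f_equal; apply one_uniq.
  - apply (coprod_ext (X := fun _ => one)); intros a.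
    change (inj (fun _ => one) a) with (pt V a).
    rewrite comp_idl -(comp_idr (pt V a)) -comp_assoc internal_id_pt int_inj_tgt.
    f_equal; apply one_uniq.
  - apply int_composable_ext; intros a b c Y w x y ex ey.
    now rewrite -!comp_assoc (mu_pair ex ey) ex !int_inj_src.
  - apply int_composable_ext; intros a b c Y w x y ex ey.
    now rewrite -!comp_assoc (mu_pair ex ey) ey !int_inj_tgt.
  - intros e; apply int_ext; intros a b.
    (* On the summand of [a] and [b] the first arrow is the identity of [a]; the reversed order
       turns this law into [ec_comp_idr]. *)
    rewrite -comp_assoc (@muE a a b _ _ _ _ _ _ (ec_id a ∘ bang _) (idm _)).
    + now rewrite -comp_assoc int_inj_over_l internal_id_pt.
    + now rewrite comp_idl comp_idr.
    + now rewrite ec_comp_idr comp_idl comp_idr.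
  - intros e; apply int_ext; intros a b.
    rewrite -comp_assoc (@muE a b b _ _ _ _ _ _ (idm _) (ec_id b ∘ bang _)).
    + now rewrite comp_idl comp_idr.
    + now rewrite -comp_assoc int_inj_over_r internal_id_pt.
    + now rewrite ec_comp_idl comp_idl comp_idr.
  - intros e1 e2 e3.
    (* A composable triple is a composable pair [v] followed by an arrow [z]; this fixes the objects
       [a], [c] and [d]. *)
    apply (composable_ext H (sA := src ∘ pb1) (tB := tgt)).
    intros a c d Y v z evz o1 o2 o3 o4; destruct (int_lift H o3 o4) as [z' z'E].
    (* The remaining object [b], inside [v], is separated by restricting along [w]. *)
    apply (fibre_ext H (f := tgt ∘ pb1 ∘ v)); intros b Z w o.
    apply lies_over_assoc in o1, o2.
    unfold lies_over in o; rewrite -!comp_assoc in o.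
    destruct (int_lift H (M := M) (i := a) (j := b) (x := pb1 ∘ (v ∘ w))) as [x xE].
    { rewrite comp_assoc; now apply lies_over_comp. }
    { exact o. }
    destruct (int_lift H (M := M) (i := b) (j := c) (x := pb2 ∘ (v ∘ w))) as [y yE].
    { unfold lies_over; rewrite comp_assoc -pb_comm -comp_assoc; exact o. }
    { rewrite comp_assoc; now apply lies_over_comp. }
    assert (zE : z ∘ w = int_inj M c d ∘ (z' ∘ w)) by now rewrite z'E comp_assoc.
    assert (xyE : mu ∘ (v ∘ w) = int_inj M a c ∘ (ec_comp a b c ∘ pair y x))
      by now apply mu_pair.
    assert (yzE : mu ∘ (pb_lift e2 ∘ (pb_lift evz ∘ w)) =
      int_inj M b d ∘ (ec_comp b c d ∘ pair (z' ∘ w) y)).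
    { apply muE; cat; assumption. }
    (* Both bracketings are now evaluated on single summands by [muE], where they agree by enriched
       associativity. *)
    rewrite -!comp_assoc; etransitivity; 
      [apply (@muE a c d _ _ _ _ _ _ (ec_comp a b c ∘ pair y x) (z' ∘ w))|].
    { cat; exact xyE. }
    { cat; exact zE. }
    rewrite -ec_comp_assoc; symmetry; apply muE.
    + cat; exact xE.
    + rewrite -comp_assoc; exact yzE.
Defined.

Definition internalize : DiscCat V := {| dc_cat := internalize_cat |}.

(** The isomorphism is the identity on objects: the fibre over [(a, b)] of the coproduct of all hom
    objects is the summand [ec_hom a b]. The map [q] comes from factoring through this summand, [p]
    from the universal property of the fibre; both inclusions are monic, so [p] and [q] are mutually
    inverse and functorial. *)
Lemma externalize_internalize :
  exists e : Hom (externalize V internalize) (E : VCat V), is_iso e.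
Proof.
  pose (D := externalize_ob internalize).
  assert (q_sig : forall a b, {q : Hom (en_hor (dc_span internalize) a b) (ec_hom a b) |
    hom_in (C := internalize) a b = int_inj M a b ∘ q}).
  { intros a b; apply constructive_indefinite_description, (int_lift H).
    - apply (hom_in_src (C := internalize)).
    - apply (hom_in_tgt (C := internalize)). }
  pose (q := fun a b => proj1_sig (q_sig a b)).
  assert (qE : forall a b, hom_in (C := internalize) a b = int_inj M a b ∘ q a b)
    by (intros a b; exact (proj2_sig (q_sig a b))).
  pose (p := fun a b => hom_lift (C := internalize) (int_inj_over_l M a b) (int_inj_over_r M a b)).
  assert (pE : forall a b, hom_in (C := internalize) a b ∘ p a b = int_inj M a b)
    by (intros a b; apply (hom_in_lift (C := internalize))).
  clearbody p q.
  assert (mul : forall a b c Y (y : Hom Y (en_hor (dc_span internalize) b c))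
    (x : Hom Y (en_hor (dc_span internalize) a b)),
    hom_mul y x = int_inj M a c ∘ (ec_comp a b c ∘ pair (q b c ∘ y) (q a b ∘ x))).
  { intros a b c Y y x; apply mu_pair; rewrite ?pb1_lift ?pb2_lift;
      now rewrite (qE _ _) comp_assoc. }
  assert (pq : forall a b, p a b ∘ q a b = idm _).
  { intros a b; apply hom_in_mono; now rewrite comp_assoc pE -qE comp_idr. }
  assert (qp : forall a b, q a b ∘ p a b = idm _).
  { intros a b; apply (int_inj_mono H (M := M)); now rewrite comp_assoc -qE pE comp_idr. }
  assert (q_comp : forall a b c, q a c ∘ hom_comp (C := internalize) a b c =
    ec_comp a b c ∘ tmap (q b c) (q a b)).
  { intros a b c; apply (int_inj_mono H (M := M)).
    rewrite comp_assoc -qE -(comp_idr (hom_comp _ _ _)) -pair_pr hom_in_comp.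
    apply mul. }
  assert (q_id : forall a, q a a ∘ hom_id (C := internalize) a = ec_id a).
  { intros a; apply (int_inj_mono H (M := M)).
    rewrite comp_assoc -qE hom_in_idE -(comp_idr (pt V a)) -(comp_idr (ec_id a)).
    apply internal_id_pt. }
  assert (p_comp : forall a b c, p a c ∘ ec_comp a b c =
    hom_comp (C := internalize) a b c ∘ tmap (p b c) (p a b)).
  { intros a b c; apply hom_in_mono; unfold tmap.
    rewrite comp_assoc pE hom_in_comp mul !(comp_assoc (q _ _)) !qp !comp_idl.
    now rewrite pair_pr comp_idr. }
  assert (p_id : forall a, p a a ∘ ec_id a = hom_id (C := internalize) a).
  { intros a; now rewrite -q_id comp_assoc pq comp_idl. }
  exists (@Build_EnrichedFunctor V D E (fun a => a) q q_comp q_id).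
  exists (@Build_EnrichedFunctor V E D (fun a => a) p p_comp p_id).
  split; apply enriched_functor_eq; intros a b; [apply pq | apply qp].
Qed.

End Internalization.

Lemma externalize_weak_equivalence (V : BaseCategory) :
  fibre_decomposition V -> weak_equivalence (externalize V).
Proof.
  intros H; split.
  - now apply externalize_full.
  - now apply externalize_faithful.
  - intros E; destruct (internal_comp_sig H E) as [mu muE].
    exists (internalize H muE); apply externalize_internalize.
Qed.

Theorem corollary4p8 (V : BaseCategory)
  (h : (forall I : small, is_adjoint_equivalence (family_adjunction V I)) \/
       extensive V \/
       oplax_double_equivalence (Int V) \/
       lax_double_equivalence (En V)) :
  equivalent_categories (VCat V) (CatD V).
Proof.
  apply (weak_equivalence_inverse (F := externalize V)), externalize_weak_equivalence.
  now apply conditions_fibre_decomposition.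
Qed.
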